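(* Let $\delta\in(0,n]$, $p\in[1,\infty)$ and $w\in\mathcal A_{p,\delta}$. Then there exists a constant $\gamma\in(0,1)$ such that $w^{1+\gamma}\in\mathcal A_{p,\delta}$.
   Context: A cube $Q\subset\mathbb R^n$ is a left-open right-closed cube with sides parallel to the axes; $l(Q)$ is its edge length. For $\delta\in(0,n]$ and $E\subset\mathbb R^n$, the Hausdorff content is $\mathcal H^\delta_\infty(E):=\inf\{\sum_i l(Q_i)^\delta:\ E\subset\bigcup_i Q_i\}$, the infimum over all finite or countable coverings of $E$ by cubes. For $E\subset\mathbb R^n$ and a non-negative function $g$ (no measurability required) the Choquet integral is $\int_E g\,d\mathcal H^\delta_\infty:=\int_0^\infty \mathcal H^\delta_\infty(\{x\in E: g(x)>t\})\,dt$. ''Almost everywhere'' with respect to $\mathcal H^\delta_\infty$ means outside a set of zero $\mathcal H^\delta_\infty$-content. A capacitary weight is a non-negative function $w$ with $\int_E w\,d\mathcal H^\delta_\infty<\infty$ for all compact $E$ and $w\in(0,\infty)$ $\mathcal H^\delta_\infty$-almost everywhere. For $p\in(1,\infty)$, $w\in\mathcal A_{p,\delta}$ means $w$ is a capacitary weight with $[w]_{\mathcal A_{p,\delta}}:=\sup_Q\{\frac1{\mathcal H^\delta_\infty(Q)}\int_Qw\,d\mathcal H^\delta_\infty\}\{\frac1{\mathcal H^\delta_\infty(Q)}\int_Qw^{-\frac1{p-1}}d\mathcal H^\delta_\infty\}^{p-1}<\infty$ (supremum over all cubes). $w\in\mathcal A_{1,\delta}$ means $w$ is a capacitary weight with $[w]_{\mathcal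 A_{1,\delta}}:=\inf\{K\in(0,\infty):\ \mathcal M_{\mathcal H^\delta_\infty}w\le Kw\ \ \mathcal H^\delta_\infty\text{-a.e.}\}<\infty$, where $\mathcal M_{\mathcal H^\delta_\infty}f(x):=\sup_{Q\ni x}\frac1{\mathcal H^\delta_\infty(Q)}\int_Q|f|\,d\mathcal H^\delta_\infty$, the supremum over all cubes containing $x$. *)

(* Defs.v *)
From HB Require Import structures.
From mathcomp Require Import all_boot all_order all_algebra.
From mathcomp Require Import all_classical all_reals all_analysis.

Set Implicit Arguments.
Unset Strict Implicit.
Unset Printing Implicit Defensive.

Import Order.TTheory GRing.Theory Num.Theory.
Import numFieldNormedType.Exports.

Local Open Scope classical_set_scope.
Local Open Scope ring_scope.
Local Open Scope ereal_scope.

Record cube (R : realType) (n : nat) := Cube {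
  corner : 'rV[R]_n ;
  edge : R ;
  edge_gt0 : (0 < edge)%R }.

Definition cube_set (R : realType) (n : nat) (Q : cube R n) : set 'rV[R]_n :=
  [set x | forall i : 'I_n,
     (corner Q ord0 i < x ord0 i <= corner Q ord0 i + edge Q)%R].

(* A finite or countable covering is a family of cubes indexed by an arbitrary
   (finite or infinite, possibly empty) set D of natural numbers; the values
   of the family outside D are irrelevant. *)
Definition hcontent (R : realType) (n : nat) (delta : R)
    (E : set 'rV[R]_n) : \bar R :=
  ereal_inf [set s : \bar R | exists (D : set nat) (Q : nat -> cube R n),
    E `<=` \bigcup_(i in D) cube_set (Q i) /\
    s = \esum_(i in D) (powR (edge (Q i)) delta)%:E].

(* The integrand is monotone in t, hence measurable, for every g. *)
Definition choquet (R : realType) (n : nat) (delta : R)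
    (E : set 'rV[R]_n) (g : 'rV[R]_n -> \bar R) : \bar R :=
  \int[@lebesgue_measure R]_(t in `]0%R, +oo[)
    hcontent delta [set x | E x /\ t%:E < g x].

Definition hcontent_ae (R : realType) (n : nat) (delta : R)
    (P : 'rV[R]_n -> Prop) : Prop :=
  hcontent delta [set x | ~ P x] = 0.

Definition cube_average (R : realType) (n : nat) (delta : R)
    (Q : cube R n) (g : 'rV[R]_n -> \bar R) : \bar R :=
  (hcontent delta (cube_set Q))^-1 * choquet delta (cube_set Q) g.

Definition capacitary_maximal (R : realType) (n : nat) (delta : R)
    (f : 'rV[R]_n -> \bar R) (x : 'rV[R]_n) : \bar R :=
  ereal_sup [set cube_average delta Q (fun y => `|f y|)
            | Q in [set Q : cube R n | cube_set Q x]].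

(* Weights take values in [0, +oo]; real-valued weights are a special case. *)
Definition capacitary_weight (R : realType) (n : nat) (delta : R)
    (w : 'rV[R]_n -> \bar R) : Prop :=
  [/\ forall x, 0 <= w x,
      forall E : set 'rV[R]_n, compact E -> choquet delta E w < +oo
    & hcontent_ae delta (fun x => 0 < w x < +oo)].

(* The power w^(-1/(p-1)) is written (w^-1)^(1/(p-1)): the inverse of \bar R
   has 0^-1 = +oo and +oo^-1 = 0, whereas poweR with a negative exponent sends
   0 to 0 and +oo to +oo. *)
Definition Ap_const (R : realType) (n : nat) (p delta : R)
    (w : 'rV[R]_n -> \bar R) : \bar R :=
  ereal_sup [set cube_average delta Q w *
                 poweR (cube_average delta Q
                          (fun x => poweR (w x)^-1 (p - 1)^-1%R)) (p - 1)%R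
            | Q in [set: cube R n]].

Definition A1_const (R : realType) (n : nat) (delta : R)
    (w : 'rV[R]_n -> \bar R) : \bar R :=
  ereal_inf [set K%:E | K in [set K : R | (0 < K)%R /\
    hcontent_ae delta (fun x => capacitary_maximal delta w x <= K%:E * w x)]].

Definition Apd_const (R : realType) (n : nat) (p delta : R)
    (w : 'rV[R]_n -> \bar R) : \bar R :=
  if p == 1%R then A1_const delta w else Ap_const p delta w.

(* Meaningful for 1 <= p and 0 < delta <= n. *)
Definition muckenhoupt (R : realType) (n : nat) (p delta : R)
    (w : 'rV[R]_n -> \bar R) : Prop :=
  capacitary_weight delta w /\ Apd_const p delta w < +oo.

(* Main.v *)
Require Import Defs.
From mathcomp Require Import all_boot all_order all_algebra.
From mathcomp Require Import all_classical all_reals all_analysis.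
From mathcomp Require Import measurable_realfun.
From mathcomp Require Import ring lra.
Import Order.TTheory GRing.Theory Num.Theory.
Local Open Scope ring_scope.
Import numFieldNormedType.Exports.
Local Open Scope classical_set_scope.
Local Open Scope ereal_scope.

Set Implicit Arguments.
Unset Strict Implicit.
Unset Printing Implicit Defensive.

(** The heart of the matter is a reverse Hoelder inequality ([reverse_hoelder]):
    there are [g0 > 0] and [C] such that, for [0 < gamma <= g0] and all cubes [P],
    the average of [w `^ (1 + gamma)] over [P] is at most [C] times the power
    [1 + gamma] of the average of [w].

    It holds for every locally integrable weight that is, in each cube, larger than
    [alpha] times its average on a set of at least half the content. For [p > 1] this
    follows from Chebyshev's inequality applied to the dual weight
    [w `^ (- (p - 1)^-1)] ([dual_weight_large]); by symmetry the dual weight has the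
    same property. For [p = 1] it is immediate, because almost everywhere [w]
    is at least a multiple of its averages. The reverse Hoelder inequality then gives
    the condition for [w `^ (1 + gamma)] ([Ap_power] and [A1_power]).

    The reverse Hoelder inequality rests on an estimate for level sets
    ([choquet_level_le]): if [lam] is at least the average of [w] over [Q], the
    integral of [w] over the part of [Q] where [w > lam] is at most a constant times
    [lam * H A], where [A] is the part of [Q] where [w > alpha * lam]. Classically one
    decomposes [Q] at height [lam] and adds up the measures of the pieces, but the
    content is not additive on disjoint sets. Instead, an arbitrary covering of [A] is
    modified. It may consist of dyadic cells of [Q] ([dyadic_cover]). A cell contained
    in a dyadic cell over which the average of [w] exceeds [lam] is replaced by the
    largest such cell [R]; the parent of [R] has average at most [lam], so that of [R]
    is at most [2 `^ delta * lam]. As [A] fills at least half the content of [R], the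
    cells of the covering inside [R] cost at least half as much as [R]. The modified
    covering is thus not much more expensive, and summing the integrals over its
    cells gives the estimate.

    At the levels [a * alpha^-1 ^+ j], where [a] is the average of [w], the estimate
    bounds the tails of a series by its terms. Hence the contents of the level sets,
    multiplied by the levels, decay geometrically ([tail_decay]), and a small
    additional power of the level does not destroy the convergence. *)

(** * Hausdorff content *)

Section Content.
Context {R : realType} {n : nat} (delta : R).
Implicit Types (E F : set 'rV[R]_n) (Q P : cube R n).

Local Notation H := (@hcontent R n delta).
Local Notation vol Q := (edge Q `^ delta)%R.

Lemma hcontent_ge0 E : 0 <= H E.
Proof.
apply: le_ereal_inf_tmp => _ [D [Q [_ ->]]].
by apply: esum_ge0 => i _; rewrite lee_fin powR_ge0.
Qed.

Lemma le_hcontent E F : E `<=` F -> H E <= H F.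
Proof.
move=> EF; apply: ereal_inf_le_tmp => _ [D [Q [FQ ->]]].
by exists D, Q; split=> //; apply: subset_trans FQ.
Qed.

Lemma hcontent_le_cover (T : countType) (S : set T) (Q : T -> cube R n) E :
  E `<=` \bigcup_(t in S) cube_set (Q t) ->
  H E <= \esum_(t in S) (vol (Q t))%:E.
Proof.
move=> EQ.
pose Q0 : cube R n := Cube 0%R ltr01.
pose Q' k := if unpickle k is Some t then Q t else Q0.
have Q'E t : Q' (pickle t) = Q t by rewrite /Q' pickleK.
apply: ereal_inf_lbound; exists (pickle @` S), Q'; split.
  move=> x /EQ[t St Qtx]; exists (pickle t); first by exists t.
  by rewrite Q'E.
rewrite (esum_image S pickle (fun k => (vol (Q' k))%:E)).
  by apply: eq_esum => t _; rewrite Q'E.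
by move=> s t _ _; apply: (pcan_inj pickleK).
Qed.

(** Near-optimal coverings of the pieces are put together; the errors
    [e / 2 ^ (pickle t).+1] add up to at most [e]. *)
Lemma hcontent_subadditive (T : countType) (S : set T)
    (F : T -> set 'rV[R]_n) E :
  E `<=` \bigcup_(t in S) F t -> H E <= \esum_(t in S) H (F t).
Proof.
move=> EF.
have [->|fin] := eqVneq (\esum_(t in S) H (F t)) +oo; first by rewrite leey.
apply/lee_addgt0Pr => e e0.
pose eps (t : T) : R := (e / (2 ^ (pickle t).+1)%:R)%R.
have eps0 t : (0 < eps t)%R by rewrite divr_gt0// ltr0n expn_gt0.
have /choice[DQ DQP] : forall t, exists DQ : set nat * (nat -> cube R n), S t ->
    F t `<=` \bigcup_(i in DQ.1) cube_set (DQ.2 i) /\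
    \esum_(i in DQ.1) (vol (DQ.2 i))%:E <= H (F t) + (eps t)%:E.
  move=> t; have [St|nSt] := pselect (S t); last first.
    by exists (set0, fun=> Cube 0%R ltr01).
  have Ftoo : H (F t) \is a fin_num.
    rewrite ge0_fin_numE ?hcontent_ge0//; apply: le_lt_trans (_ : _ < +oo).
      2: by rewrite ltey; exact: fin.
    apply: esum_ge; exists [set t]; last by rewrite fsbig_set1.
    by split; [exact: finite_set1|move=> _ ->].
  have : H (F t) < H (F t) + (eps t)%:E by rewrite lteDl// lte_fin.
  move=> /ereal_inf_lt[_ [D [Q [FQ ->]]] /ltW lt].
  by exists (D, Q).
apply: (@le_trans _ _
    (\esum_(k in S `*`` (fun t => (DQ t).1)) (vol ((DQ k.1).2 k.2))%:E)).
  apply: hcontent_le_cover => x /EF[t St /(DQP t St).1[i Di Qx]].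
  by exists (t, i).
rewrite -(@esum_esum _ _ _ S (fun t => (DQ t).1) (fun t i => (vol ((DQ t).2 i))%:E)); last first.
  by move=> *; rewrite lee_fin powR_ge0.
apply: (@le_trans _ _ (\esum_(t in S) (H (F t) + (eps t)%:E))).
  by apply: le_esum => t St; exact: (DQP t St).2.
rewrite esumD; first last.
- by move=> t _; rewrite lee_fin ltW.
- by move=> t _; exact: hcontent_ge0.
rewrite leeD2l//.
rewrite -(esum_image S pickle (fun k => (e / (2 ^ k.+1)%:R)%:E)); last first.
  by move=> s t _ _; apply: (pcan_inj pickleK).
rewrite -[X in esum X]set_mem_set -nneseries_esum.
  exact/epsilon_trick0/ltW.
by move=> k _; rewrite lee_fin divr_ge0// ltW.
Qed.

Lemma hcontent0 : H set0 = 0.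
Proof.
apply/eqP; rewrite eq_le hcontent_ge0 andbT.
by apply: le_trans (@hcontent_subadditive nat set0 (fun=> set0) _ _) _ => //;
  rewrite esum_set0.
Qed.

Lemma hcontentU E F : H (E `|` F) <= H E + H F.
Proof.
have := @hcontent_subadditive bool setT (fun b => if b then E else F) (E `|` F).
move=> /(_ _)/le_trans; apply.
  by move=> x [Ex|Fx]; [exists true|exists false].
rewrite (esum_fset (@finite_finset bool setT)); last by move=> *; exact: hcontent_ge0.
have -> : [set: bool] = [set` [:: true; false]].
  by apply/seteqP; split=> // -[].
by rewrite -fsbig_seq//= !big_cons big_nil /= adde0.
Qed.

Lemma hcontent_cube_le Q : H (cube_set Q) <= (vol Q)%:E.
Proof.
have := @hcontent_le_cover unit setT (fun=> Q) (cube_set Q).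
move=> /(_ _)/le_trans; apply; first by move=> x Qx; exists tt.
rewrite (_ : setT = [set tt]) ?esum_set1 ?lee_fin ?powR_ge0//.
by apply/seteqP; split=> // -[].
Qed.

End Content.

(** * The content of a cube *)

Lemma measurable_nneseries d (T : measurableType d) (R : realType)
    (h : nat -> T -> \bar R) :
  (forall i x, 0 <= h i x) -> (forall i, measurable_fun setT (h i)) ->
  measurable_fun setT (fun x => \sum_(i <oo) h i x).
Proof.
move=> h0 mh.
exact: (@ge0_emeasurable_sum _ _ _ setT h xpredT (fun i x _ _ => h0 i x)
  (fun i _ => mh i)).
Qed.

Lemma esumZl (R : realType) (T : choiceType) (S : set T) (a : T -> \bar R)
    (c : R) : (0 <= c)%R -> (forall t, S t -> 0 <= a t) ->
  \esum_(t in S) (c%:E * a t) = c%:E * \esum_(t in S) a t.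
Proof.
move=> c0 a0; rewrite esum_mkcond [in RHS]esum_mkcond.
pose b t := if t \in S then a t else 0.
have b0 t : 0 <= b t by rewrite /b; case: ifPn => // /set_mem/a0.
have -> : \esum_(t in [set: T]) (if t \in S then c%:E * a t else 0) =
    \esum_(t in [set: T]) (c%:E * b t).
  by apply: eq_esum => t _; rewrite /b; case: ifP; rewrite ?mule0.
move: c0; rewrite le_eqVlt => /predU1P[<-|c0].
  by rewrite mul0e esum1// => t _; rewrite mul0e.
have le (f : T -> \bar R) r : (0 < r)%R -> (forall t, 0 <= f t) ->
    r%:E * (\esum_(t in setT) f t) <= \esum_(t in setT) (r%:E * f t).
  move=> r0 f0; rewrite -lee_pdivlMl//; apply: ge_ereal_sup => _ [X [finX XS] <-].
  rewrite lee_pdivlMl//. apply: esum_ge; exists X => //.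
  by rewrite ge0_mule_fsumr.
apply/eqP; rewrite eq_le le// andbT -lee_pdivrMl//.
apply: le_trans (le _ c^-1%R _ _) _; rewrite ?invr_gt0//.
  by move=> t; rewrite mule_ge0// lee_fin ltW.
by apply: le_esum => t _; rewrite muleA -EFinM mulVf ?gt_eqF// mul1e.
Qed.

Lemma integral_indic_itv (R : realType) (A c l : R) :
  (0 <= A)%R -> (0 <= l)%R ->
  \int[@lebesgue_measure R]_y (A * \1_(`]c, (c + l)%R]%classic) y)%:E
  = (A * l)%:E.
Proof.
move=> A0 l0; under eq_integral do rewrite EFinM.
rewrite ge0_integralZl_EFin//; first last.
- by apply/measurable_EFinP; apply: measurable_indic; exact: measurable_itv.
rewrite integral_indic//= setIT lebesgue_measure_itv/= lte_fin ltrDl.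
case: ltP => l0'; first by rewrite -EFinD addrAC subrr add0r EFinM.
by rewrite (_ : l = 0%R) ?mulr0 ?mule0//; apply/eqP; rewrite eq_le l0 l0'.
Qed.

(** A pointwise comparison between the indicator of a box and a series of such
    indicators becomes one of volumes: integrating out the last coordinate turns
    its factor into an edge length, and the induction continues with the
    remaining coordinates. One-dimensional integrals suffice. *)
Lemma box_le (R : realType) (m : nat) (r l : R) (c : nat -> R)
    (s e : nat -> R) (d : nat -> nat -> R) :
  (0 <= r)%R -> (0 <= l)%R -> (forall i, 0 <= s i)%R -> (forall i, 0 <= e i)%R ->
  (forall x : nat -> R,
    (r * \prod_(k < m) \1_(`]c k, (c k + l)%R]%classic) (x k))%:E <=
    \sum_(i <oo)
      (s i * \prod_(k < m) \1_(`]d i k, (d i k + e i)%R]%classic) (x k))%:E) ->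
  (r * l ^+ m)%:E <= \sum_(i <oo) (s i * e i ^+ m)%:E.
Proof.
elim: m r s => [|m IH] r s r0 l0 s0 e0 le_rs.
  have := le_rs (fun=> 0%R); rewrite big_ord0 expr0.
  by under eq_eseriesr do rewrite big_ord0.
have -> : (r * l ^+ m.+1 = (r * l) * l ^+ m)%R by rewrite exprS mulrA.
under eq_eseriesr do rewrite exprS mulrA.
apply: IH => //; [exact: mulr_ge0|by move=> i; exact: mulr_ge0|].
move=> x.
set A := (\prod_(k < m) _)%R.
pose B i := (\prod_(k < m) \1_(`]d i k, (d i k + e i)%R]%classic) (x k) : R)%R.
have A0 : (0 <= A)%R by apply: prodr_ge0.
have B0 i : (0 <= B i)%R by apply: prodr_ge0.
have le_AB y : (r * A * \1_(`]c m, (c m + l)%R]%classic) y)%:E <=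
    \sum_(i <oo) (s i * B i * \1_(`]d i m, (d i m + e i)%R]%classic) y)%:E.
  have := le_rs (fun k => if k == m then y else x k).
  have drop (D : nat -> set R) :
      (\prod_(k < m.+1) \1_(D k) (if k == m :> nat then y else x k) =
       (\prod_(k < m) \1_(D k) (x k)) * \1_(D m) y :> R)%R.
    rewrite big_ord_recr/= eqxx; congr (_ * _)%R; apply: eq_bigr => k _.
    by rewrite ltn_eqF.
  rewrite (drop (fun k => `]c k, (c k + l)%R]%classic)) mulrA.
  by under eq_eseriesr => i _ do
    rewrite (drop (fun k => `]d i k, (d i k + e i)%R]%classic)) mulrA.
have mind (a u v : R) :
    measurable_fun setT (fun y : R => (a * \1_(`]u, v]%classic) y)%:E).
  by apply/measurable_EFinP; apply: measurable_funM => //;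
    apply: measurable_indic; exact: measurable_itv.
have ge0 a u v (y : R) : (0 <= a)%R -> 0 <= (a * \1_(`]u, v]%classic) y)%:E.
  by move=> a0; rewrite lee_fin mulr_ge0.
have le_int : \int[@lebesgue_measure R]_y
      (r * A * \1_(`]c m, (c m + l)%R]%classic) y)%:E <=
    \int[@lebesgue_measure R]_y (\sum_(i <oo)
      (s i * B i * \1_(`]d i m, (d i m + e i)%R]%classic) y)%:E).
  apply: ge0_le_integral => //.
  - by move=> y _; apply: ge0; exact: mulr_ge0.
  - exact: mind.
  - apply: measurable_nneseries => [i y|i]; last exact: mind.
    by apply: ge0; exact: mulr_ge0.
move: le_int; rewrite integral_nneseries//; first last.
- by move=> i y _; apply: ge0; exact: mulr_ge0.
- by move=> i; exact: mind.
rewrite integral_indic_itv ?mulr_ge0// => le_int.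
rewrite mulrAC; apply: (le_trans le_int); apply: lee_nneseries => [i _ _|i _].
  by apply: integral_ge0 => y _; apply: ge0; exact: mulr_ge0.
by rewrite integral_indic_itv ?mulr_ge0// mulrAC.
Qed.

Section ContentCube.
Context {R : realType} {n : nat} (delta : R).
Local Notation H := (@hcontent R n delta).
Local Notation vol Q := (edge Q `^ delta)%R.

Lemma prod_indic_cube (Q : cube R n) (x : 'rV[R]_n) :
  (\prod_(k < n) \1_(`]corner Q ord0 k, (corner Q ord0 k + edge Q)%R]%classic)
    (x ord0 k) = (\1_(cube_set Q) x : R))%R.
Proof.
rewrite indicE; have [Qx|nQx] := pselect (cube_set Q x).
  rewrite big1 ?mem_set// => k _.
  by rewrite indicE mem_set//= in_itv/= Qx.
have [k nk] : exists k : 'I_n, ~ (corner Q ord0 k < x ord0 k <=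
  corner Q ord0 k + edge Q)%R by apply/existsNP.
rewrite memNset// (bigD1 k)//= indicE memNset ?mul0r//=.
Qed.

(** The lower bound of the content in the case where the exponent is the
    dimension. *)
Lemma cube_volume_cover (D : set nat) (P : nat -> cube R n) (Q : cube R n) :
  cube_set Q `<=` \bigcup_(i in D) cube_set (P i) ->
  (edge Q ^+ n)%:E <= \esum_(i in D) (edge (P i) ^+ n)%:E.
Proof.
move=> QP.
(* Corners extended by 0 to all indices, as [box_le] wants sequences. *)
pose co (Q : cube R n) (k : nat) : R :=
  if insub k is Some i then corner Q ord0 i else 0%R.
have coE (Q' : cube R n) (k : 'I_n) : co Q' k = corner Q' ord0 k.
  by rewrite /co insubT// => lt; congr (corner _ _ _); exact/val_inj.
have := @box_le R n 1%R (edge Q) (co Q) (fun i => (i \in D)%:R)%R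
  (fun i => edge (P i)) (fun i => co (P i)) ler01 (ltW (edge_gt0 Q)) _ _ _.
rewrite mul1r => le; rewrite esum_mkcond -nneseries_esumT; last first.
  by move=> i; case: ifP => // _; rewrite lee_fin exprn_ge0// ltW// edge_gt0.
under eq_eseriesr.
  move=> i _; rewrite (_ : (if _ then _ else _) =
    ((i \in D)%:R * edge (P i) ^+ n)%:E); last first.
    by case: (i \in D); rewrite ?mul1r ?mul0r.
  over.
apply: le => [i|i|x]; [by case: (i \in D)|exact/ltW/edge_gt0|].
pose y : 'rV[R]_n := (\row_k x k)%R.
have prodE (Q' : cube R n) : (\prod_(k < n)
    \1_(`]co Q' k, (co Q' k + edge Q')%R]%classic) (x k) =
    (\1_(cube_set Q') y : R))%R.
  rewrite -prod_indic_cube; apply: eq_bigr => k _.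
  by rewrite coE mxE.
rewrite prodE mul1r.
under eq_eseriesr do rewrite prodE.
have ge0 i : 0 <= ((i \in D)%:R * \1_(cube_set (P i)) y : R)%:E.
  by rewrite lee_fin mulr_ge0.
have [Qy|nQy] := pselect (cube_set Q y); last first.
  by rewrite indicE memNset//; exact: nneseries_ge0.
have [i Di Piy] := QP _ Qy.
rewrite nneseries_esumT//; apply: esum_ge; exists [set i].
  by split; [exact: finite_set1|].
by rewrite fsbig_set1 !indicE !mem_set// mul1r.
Qed.

(** A covering of [Q] containing a cube at least as large as [Q] costs enough by
    itself. Otherwise all the ratios [edge (P i) / edge Q] are below one, so that
    lowering their exponent from [n] to [delta] increases them, and the comparison
    of volumes applies. *)
Lemma hcontent_cube Q : (0 < delta <= n%:R)%R -> H (cube_set Q) = (vol Q)%:E.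
Proof.
move=> /andP[d0 dn]; apply/eqP; rewrite eq_le hcontent_cube_le/=.
apply: le_ereal_inf_tmp => _ [D [P [QP ->]]].
set L := edge Q; have L0 : (0 < L)%R by exact: edge_gt0.
have [[i Di Li]|small] := pselect (exists2 i, D i & (L <= edge (P i))%R).
  apply: esum_ge; exists [set i]; first by split; [exact: finite_set1|move=> _ ->].
  by rewrite fsbig_set1 lee_fin ge0_ler_powR// ?nnegrE ltW// edge_gt0.
have Ln0 : (0 < L ^+ n)%R by rewrite exprn_gt0.
have -> : (L `^ delta)%:E = ((L `^ delta) / L ^+ n)%:E * (L ^+ n)%:E.
  by rewrite -EFinM mulfVK// gt_eqF.
have c0 : (0 <= (L `^ delta) / L ^+ n)%R by rewrite divr_ge0 ?powR_ge0// ltW.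
apply: (@le_trans _ _ (((L `^ delta) / L ^+ n)%:E * \esum_(i in D) (edge (P i) ^+ n)%:E)).
  by rewrite lee_wpmul2l ?lee_fin//; exact: cube_volume_cover.
rewrite -esumZl//; last first.
  by move=> i _; rewrite lee_fin exprn_ge0// ltW// edge_gt0.
apply: le_esum => i Di; rewrite -EFinM lee_fin.
have Pi0 : (0 < edge (P i))%R by exact: edge_gt0.
have PiL : (edge (P i) < L)%R.
  by rewrite ltNge; apply/negP => LP; apply: small; exists i.
have -> : edge (P i) = (L * (edge (P i) / L))%R by rewrite mulrCA divff ?mulr1 ?gt_eqF.
set u := (edge (P i) / L)%R.
have u0 : (0 < u)%R by rewrite divr_gt0.
have u1 : (u <= 1)%R by rewrite ler_pdivrMr// mul1r ltW.
rewrite powRM ?(ltW L0) ?(ltW u0)// exprMn mulrA mulfVK ?gt_eqF//.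
rewrite ler_pM2l ?powR_gt0// -powR_mulrn ?(ltW u0)//.
by apply: ger_powR => //; rewrite u0 u1.
Qed.

End ContentCube.

(** * The Choquet integral *)

Lemma nonincreasing_emeasurable (R : realType) (f : R -> \bar R) (D : set R) :
  (forall s t, (s <= t)%R -> f t <= f s) -> measurable_fun D f.
Proof.
move=> fni; apply: measurable_funS measurableT (subsetT _) _.
apply: (measurability _ (ErealGenCInfty.measurableE R)) => _ [_ [r ->] <-].
rewrite setTI; apply: is_interval_measurable => s t /=.
rewrite !in_itv/= !andbT => rs rt u /andP[_ ut].
by rewrite in_itv/= andbT (le_trans rt)// fni.
Qed.

Section Choquet.
Context {R : realType} {n : nat} (delta : R).
Implicit Types (E F : set 'rV[R]_n) (g h : 'rV[R]_n -> \bar R).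

Local Notation H := (@hcontent R n delta).
Local Notation choquet := (@choquet R n delta).
Local Notation mu := (@lebesgue_measure R).
Local Notation level E g t := [set x | E x /\ t%:E < g x].

Lemma measurable_level E g (D : set R) :
  measurable_fun D (fun t : R => H (level E g t)).
Proof.
apply: nonincreasing_emeasurable => s t st; apply: le_hcontent => x [Ex tg].
by split=> //; apply: le_lt_trans tg; rewrite lee_fin.
Qed.

Lemma choquet_ge0 E g : 0 <= choquet E g.
Proof. by apply: integral_ge0 => t _; exact: hcontent_ge0. Qed.

Lemma le_choquet E F g h : E `<=` F -> (forall x, E x -> g x <= h x) ->
  choquet E g <= choquet F h.
Proof.
move=> EF gh; apply: ge0_le_integral => //.
- by move=> t _; exact: hcontent_ge0.
- exact: measurable_level.
- exact: measurable_level.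
move=> t _; apply: le_hcontent => x [Ex tg].
by split; [exact: EF|exact: lt_le_trans (gh x Ex)].
Qed.

(** The Choquet integral need not be subadditive in the integrand, but for a fixed
    integrand it is subadditive in the domain: at each level this is the
    subadditivity of the content, and the levels are then integrated against the
    Lebesgue measure, for which series may be exchanged. *)
Lemma choquet_subadditive (T : countType) (S : set T)
    (F : T -> set 'rV[R]_n) E g :
  E `<=` \bigcup_(t in S) F t -> choquet E g <= \esum_(t in S) choquet (F t) g.
Proof.
move=> EF.
(* The family [F] over [S], spread over the natural numbers. *)
pose G k := if pickle_inv k is Some t then (if t \in S then F t else set0) else set0.
have choquet0 : choquet set0 g = 0.
  rewrite /Defs.choquet; under eq_integral => t _.
    rewrite (_ : level set0 g t = set0) ?hcontent0; first over.
    by apply/seteqP; split=> // x [].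
  by rewrite integral0.
apply: (@le_trans _ _ (\sum_(k <oo) choquet (G k) g)).
  rewrite -integral_nneseries//; first last.
  - by move=> k t _; exact: hcontent_ge0.
  - by move=> k; exact: measurable_level.
  apply: ge0_le_integral => //.
  - by move=> t _; exact: hcontent_ge0.
  - exact: measurable_level.
  - apply: (measurable_funS measurableT) => //.
    apply: measurable_nneseries => [k t|k]; first exact: hcontent_ge0.
    exact: measurable_level.
  move=> t _; rewrite nneseries_esumT//; last by move=> k; exact: hcontent_ge0.
  apply: hcontent_subadditive => x [/EF[s Ss Fsx] tg].
  by exists (pickle s) => //; rewrite /G pickleK_inv mem_set.
rewrite nneseries_esumT//; last by move=> k; exact: choquet_ge0.
have GE t : S t -> G (pickle t) = F t by move=> St; rewrite /G pickleK_inv mem_set.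
under [leRHS]eq_esum => t St do rewrite -(GE t St).
rewrite -(esum_image S pickle (fun k => choquet (G k) g)); last first.
  by move=> s t _ _; apply: (pcan_inj pickleK).
rewrite [leRHS]esum_mkcond; apply: le_esum => k _.
case: ifPn => [//|/negP nSk].
rewrite /G; case Ek : (pickle_inv k) => [t|]; last by rewrite choquet0.
case: ifPn => [/set_mem St|_]; last by rewrite choquet0.
exfalso; apply: nSk; apply/mem_set; exists t => //.
by have := @pickle_invK T k; rewrite Ek.
Qed.

Lemma choquetU E F g : choquet (E `|` F) g <= choquet E g + choquet F g.
Proof.
have := @choquet_subadditive bool setT (fun b => if b then E else F) (E `|` F) g.
move=> /(_ _)/le_trans; apply.
  by move=> x [Ex|Fx]; [exists true|exists false].
rewrite (esum_fset (@finite_finset bool setT)); last by move=> *; exact: choquet_ge0.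
have -> : [set: bool] = [set` [:: true; false]].
  by apply/seteqP; split=> // -[].
by rewrite -fsbig_seq//= !big_cons big_nil /= adde0.
Qed.

Let mind (c : \bar R) (I : interval R) (D : set R) : 0 <= c ->
  measurable_fun D (fun t => c * (\1_[set` I] t)%:E).
Proof.
move=> c0; apply: measurable_funeM; apply/measurable_EFinP.
by apply: measurable_indic; exact: measurable_itv.
Qed.

Let integral_step (c : \bar R) (I : interval R) (D : set R) :
  measurable D -> 0 <= c ->
  \int[mu]_(t in D) (c * (\1_[set` I] t)%:E) = c * mu ([set` I] `&` D).
Proof.
move=> mD c0; rewrite ge0_integralZl//; first last.
- by apply/measurable_EFinP; apply: measurable_indic; exact: measurable_itv.
by rewrite integral_indic//; exact: measurable_itv.
Qed.

(** Lower Riemann sums of the level function; the closed levels are allowed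
    because only the interior of each step is used. *)
Lemma choquet_ge_sum E g (s : nat -> R) (N : nat) :
  (0 <= s 0%N)%R -> (forall j, s j <= s j.+1)%R ->
  \sum_(j < N) (s j.+1 - s j)%:E * H [set x | E x /\ (s j.+1)%:E <= g x]
  <= choquet E g.
Proof.
move=> s0 sS.
have sge0 j : (0 <= s j)%R by elim: j => // j /le_trans; apply.
pose c j := H [set x | E x /\ (s j.+1)%:E <= g x].
pose st j (t : R) : \bar R := c j * (\1_(`]s j, s j.+1[%classic) t)%:E.
have c0 j : 0 <= c j by exact: hcontent_ge0.
have st0 j t : 0 <= st j t by rewrite mule_ge0// lee_fin.
have -> : \sum_(j < N) (s j.+1 - s j)%:E * c j =
    \int[mu]_(t in `]0%R, +oo[) (\sum_(j < N) st j t).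
  rewrite ge0_integral_sum//; first last.
  - by move=> j; exact: mind.
  apply: eq_bigr => j _; rewrite integral_step// muleC; congr (_ * _).
  rewrite (_ : _ `&` _ = `]s j, s j.+1[%classic); last first.
    apply/seteqP; split=> [t []//|t /= tj]; split=> //.
    move: tj; rewrite /= !in_itv/= => /andP[tj _].
    by rewrite andbT (le_lt_trans _ tj).
  rewrite lebesgue_measure_itv/= lte_fin; case: ltP => // sj.
  by rewrite (_ : s j = s j.+1) ?subrr//; apply/le_anti; rewrite sS.
apply: ge0_le_integral => //.
- by move=> t _; exact: sume_ge0.
- by apply: emeasurable_sum => j; exact: mind.
- exact: measurable_level.
move=> t _.
(* The steps are disjoint, so at most one term is nonzero at [t]; the second
   conjunct carries this through the induction. *)
suff [//] : \sum_(j < N) st j t <= H (level E g t) /\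
  ((s N <= t)%R -> \sum_(j < N) st j t = 0).
elim: N => [|N [IH1 IH2]]; first by rewrite big_ord0; split=> //; exact: hcontent_ge0.
rewrite big_ord_recr/=; split.
  have [tN|Nt] := ltP t (s N).
    rewrite [st N t]/st indicE memNset ?mule0 ?adde0//=.
    by rewrite in_itv/= ltNge ltW.
  rewrite IH2// add0e /st indicE.
  case: (boolP (t \in _)) => [/set_mem/=|_]; last by rewrite mule0 hcontent_ge0.
  rewrite in_itv/= mule1 => /andP[_ tN].
  apply: le_hcontent => x [Ex gx]; split=> //.
  by apply: lt_le_trans gx; rewrite lte_fin.
move=> Nt; rewrite IH2 ?add0e; last exact: le_trans Nt.
by rewrite /st indicE memNset ?mule0//= in_itv/= [X in _ && X]ltNge Nt andbF.
Qed.

Lemma chebyshev E g (t : R) : (0 <= t)%R ->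
  t%:E * H [set x | E x /\ t%:E <= g x] <= choquet E g.
Proof.
move=> t0; have := @choquet_ge_sum E g (fun j => t * (j != 0%N)%:R)%R 1.
rewrite big_ord1/= mulr0 mulr1 subr0; apply=> [|[|j]]/=; by rewrite ?mulr0 ?mulr1.
Qed.

(** Upper Riemann sums. The level function is bounded by the content of the whole
    domain below the first level [s 0]. *)
Lemma choquet_le_sum E g (s : nat -> R) :
  (0 <= s 0%N)%R -> (forall j, s j <= s j.+1)%R ->
  (forall t, exists j, t <= s j)%R ->
  choquet E g <= (s 0%N)%:E * H E +
    \sum_(j <oo) (s j.+1 - s j)%:E * H (level E g (s j)).
Proof.
move=> s0 sS sy.
have sge0 j : (0 <= s j)%R by elim: j => // j /le_trans; apply.
pose c j := H (level E g (s j)).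
pose st j (t : R) : \bar R := c j * (\1_(`]s j, s j.+1]%classic) t)%:E.
have c0 j : 0 <= c j by exact: hcontent_ge0.
have st0 j t : 0 <= st j t by rewrite mule_ge0// lee_fin.
have mst j (D : set R) : measurable_fun D (st j) by exact: mind.
pose st' (t : R) : \bar R := H E * (\1_(`]0%R, s 0%N]%classic) t)%:E.
have st'0 t : 0 <= st' t by rewrite mule_ge0 ?hcontent_ge0// lee_fin.
have mst' (D : set R) : measurable_fun D st' by apply: mind; exact: hcontent_ge0.
have I' : \int[mu]_(t in `]0%R, +oo[) st' t = (s 0%N)%:E * H E.
  rewrite integral_step ?hcontent_ge0// muleC; congr (_ * _).
  rewrite (_ : _ `&` _ = `]0%R, s 0%N]%classic); last first.
    apply/seteqP; split=> [t []//|t /= tj]; split=> //.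
    by move: tj; rewrite /= !in_itv/= andbT => /andP[].
  rewrite lebesgue_measure_itv/= lte_fin; case: ltP => [_|s0'].
    by rewrite oppr0 adde0.
  by congr (_%:E); apply/le_anti; rewrite s0.
have I j : \int[mu]_(t in `]0%R, +oo[) st j t = (s j.+1 - s j)%:E * c j.
  rewrite integral_step// muleC; congr (_ * _).
  rewrite (_ : _ `&` _ = `]s j, s j.+1]%classic); last first.
    apply/seteqP; split=> [t []//|t /= tj]; split=> //.
    move: tj; rewrite /= !in_itv/= => /andP[tj _].
    by rewrite andbT (le_lt_trans _ tj).
  rewrite lebesgue_measure_itv/= lte_fin; case: ltP => // sj.
  by rewrite (_ : s j = s j.+1) ?subrr//; apply/le_anti; rewrite sS.
have mS (D : set R) : measurable D -> measurable_fun D (fun t => \sum_(j <oo) st j t).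
  move=> mD; apply: (measurable_funS measurableT) => //.
  by apply: measurable_nneseries => // j; exact: mst.
have -> : \sum_(j <oo) (s j.+1 - s j)%:E * H (level E g (s j)) =
    \int[mu]_(t in `]0%R, +oo[) (\sum_(j <oo) st j t).
  rewrite integral_nneseries//; last by move=> j; exact: mst.
  by apply: eq_eseriesr => j _; rewrite I.
rewrite -I' -ge0_integralD//; first last.
- exact: mS.
- by move=> t _; exact: nneseries_ge0.
- exact: mst'.
apply: ge0_le_integral => //.
- by move=> t _; exact: hcontent_ge0.
- exact: measurable_level.
- by apply: emeasurable_funD; [exact: mst'|exact: mS].
move=> t; rewrite /= in_itv/= andbT => t0.
have [ts0|s0t] := leP t (s 0%N).
  apply: (@le_trans _ _ (st' t)); last by rewrite leeDl// nneseries_ge0.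
  rewrite /st' indicE mem_set/= ?in_itv/= ?t0// mule1.
  by apply: le_hcontent => x [].
have [k ktk] : exists k, (s k < t <= s k.+1)%R.
  have [[|k] tk kmin] := ex_minnP (sy t).
    by rewrite leNgt s0t in tk.
  exists k; rewrite tk andbT ltNge; apply/negP => /kmin.
  by rewrite ltnn.
apply: (@le_trans _ _ (\sum_(j <oo) st j t)); last by rewrite leeDr.
rewrite nneseries_esumT//; apply: esum_ge; exists [set k].
  by split; [exact: finite_set1|].
rewrite fsbig_set1 /st indicE mem_set/= ?in_itv//= mule1.
apply: le_hcontent => x [Ex tg]; split=> //.
by case/andP: ktk => kt _; apply: lt_trans tg; rewrite lte_fin.
Qed.

End Choquet.

(** * Dyadic cells of a cube *)

Section Dyadic.
Context {R : realType} {n : nat} (Q : cube R n).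
Implicit Types (x y : 'rV[R]_n) (k : nat) (m : {ffun 'I_n -> int}).

Lemma dyadic_edge_gt0 k : (0 < edge Q / 2 ^+ k)%R.
Proof. by rewrite divr_gt0 ?edge_gt0// exprn_gt0. Qed.

(** The cell of level [k] and index [m] of the grid that subdivides [Q]. The index
    is the upper end of the cell in units of the mesh, so that the cell of a point
    is found by rounding up. Cells outside [Q] belong to the grid as well. *)
Definition dyadic_cell k m : cube R n :=
  Cube (\row_i (corner Q ord0 i + edge Q / 2 ^+ k * (m i - 1)%:~R))%R
       (dyadic_edge_gt0 k).

(** Coordinates relative to the corner of [Q], in units of the mesh. *)
Definition dyadic_pos k x (i : 'I_n) : R :=
  ((x ord0 i - corner Q ord0 i) / (edge Q / 2 ^+ k))%R.

Definition dyadic_index k x : {ffun 'I_n -> int} :=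
  [ffun i => Num.ceil (dyadic_pos k x i)].

Lemma mem_dyadic_cell k m x :
  cube_set (dyadic_cell k m) x <-> dyadic_index k x = m.
Proof.
have s0 := dyadic_edge_gt0 k.
have itvE i (z : int) : (corner Q ord0 i + edge Q / 2 ^+ k * (z - 1)%:~R <
    x ord0 i <= corner Q ord0 i + edge Q / 2 ^+ k * (z - 1)%:~R +
    edge Q / 2 ^+ k)%R = ((z - 1)%:~R < dyadic_pos k x i <= z%:~R)%R.
  rewrite /dyadic_pos ltr_pdivlMr// ler_pdivrMr// ltrBrDl lerBlDl.
  by rewrite (mulrC _ (edge Q / _)%R) -addrA intrB mulrBr mulr1 subrK (mulrC z%:~R).
split=> [xm|<- i].
  apply/ffunP => i; rewrite ffunE; apply: ceil_def; rewrite -itvE.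
  by have := xm i; rewrite mxE.
by rewrite mxE itvE ffunE ceil_itv.
Qed.

Lemma dyadic_cell0 : cube_set (dyadic_cell 0 [ffun=> 1%R]) = cube_set Q.
Proof.
apply/seteqP; split=> x Qx i; have := Qx i;
  by rewrite /= mxE ffunE subrr mulr0 addr0 expr0 divr1.
Qed.

(** The ceiling of [u] is determined by that of [2 * u], since an integer [z]
    compares with [u] as [2 * z] compares with [2 * u]. *)
Lemma dyadic_index_coarser j k x y : (j <= k)%N ->
  dyadic_index k x = dyadic_index k y -> dyadic_index j x = dyadic_index j y.
Proof.
elim: k => [|k IH]; first by rewrite leqn0 => /eqP ->.
rewrite leq_eqVlt => /predU1P[->//|]; rewrite ltnS => /IH jk xy.
apply: jk; apply/ffunP => i; rewrite !ffunE; apply: ceil_def.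
have double z : dyadic_pos k.+1 z i = (2 * dyadic_pos k z i)%R.
  rewrite /dyadic_pos exprS; have := edge_gt0 Q; have : (2 ^+ k != 0 :> R)%R.
    by rewrite expf_neq0.
  by move=> ? /gt_eqF/negbT ?; field; apply/andP.
have /ffunP/(_ i) := xy; rewrite !ffunE !double => xyi.
set z := Num.ceil (dyadic_pos k y i).
have /andP[yl yu] := ceil_itv (dyadic_pos k y i).
have Ez (u : int) : ((2 * u)%:~R = 2 * u%:~R :> R)%R by rewrite intrM.
have lt : ((2 * (z - 1))%R < Num.ceil (2 * dyadic_pos k y i)%R)%R.
  by rewrite ceil_gt_int Ez ltr_pM2l.
have le : (Num.ceil (2 * dyadic_pos k y i) <= 2 * z)%R.
  by rewrite ceil_le_int Ez ler_pM2l.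
move: lt le; rewrite -xyi ceil_gt_int ceil_le_int !Ez ltr_pM2l// ler_pM2l//.
by move=> -> ->.
Qed.

Lemma dyadic_cell_sub j k m m' x : (j <= k)%N ->
  cube_set (dyadic_cell j m) x -> cube_set (dyadic_cell k m') x ->
  cube_set (dyadic_cell k m') `<=` cube_set (dyadic_cell j m).
Proof.
move=> jk /mem_dyadic_cell <- /mem_dyadic_cell <- y /mem_dyadic_cell yx.
by apply/mem_dyadic_cell; apply: dyadic_index_coarser yx.
Qed.

(** A cube of edge at most the mesh of the grid meets at most two grid intervals
    in each direction, so [2 ^ n] cells are enough; the finest such mesh is less
    than twice the edge. A cube larger than [Q] is replaced by [Q] itself. *)
Lemma dyadic_cover (P : cube R n) :
  exists (k : nat) (F : {ffun 'I_n -> bool} -> {ffun 'I_n -> int}),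
    (edge Q / 2 ^+ k <= 2 * edge P)%R /\
    cube_set Q `&` cube_set P `<=` \bigcup_b cube_set (dyadic_cell k (F b)).
Proof.
have Q0 := edge_gt0 Q; have P0 := edge_gt0 P.
have [QP|PQ] := ltP (edge Q) (edge P).
  exists 0%N, (fun=> [ffun=> 1%R]); split; first by rewrite expr0 divr1; lra.
  by move=> x [Qx _]; exists [ffun=> true] => //; rewrite dyadic_cell0.
have exk : exists k, (edge Q / 2 ^+ k < edge P)%R.
  exists (Num.bound (edge Q / edge P)%R).
  by rewrite ltr_pdivrMr ?exprn_gt0// mulrC -ltr_pdivrMr// upper_nthrootP.
have [[|k] kP kmin] := ex_minnP exk; first by move: kP; rewrite expr0 divr1 ltNge PQ.
have Pk : (edge P <= edge Q / 2 ^+ k)%R.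
  by rewrite leNgt; apply/negP => /kmin; rewrite ltnn.
(* In direction [i] the cube [P] lies in an interval of length one in units of the
   mesh starting at [t0 i]; the bit [b i] tells which of the two grid intervals
   meeting it is meant. *)
pose t0 := dyadic_pos k (corner P).
exists k, (fun b : {ffun 'I_n -> bool} => [ffun i => (Num.ceil (t0 i) + (b i : nat)%:Z)%R]); split.
  move: kP; rewrite exprS invfM mulrA => kP.
  have -> : (edge Q / 2 ^+ k = 2 * (edge Q / 2 / 2 ^+ k))%R by field; exact: expf_neq0.
  by rewrite ler_pM2l// ltW.
move=> x [_ Px].
exists [ffun i => ((Num.ceil (t0 i))%:~R < dyadic_pos k x i)%R] => //.
apply/mem_dyadic_cell/ffunP => i; rewrite !ffunE; apply: ceil_def.
have s0 := dyadic_edge_gt0 k.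
have t0x : (t0 i < dyadic_pos k x i)%R.
  rewrite ltr_pM2r ?invr_gt0// ltrD2r.
  by have /andP[] := Px i.
have xt1 : (dyadic_pos k x i <= t0 i + 1)%R.
  rewrite /t0 /dyadic_pos -[X in (_ <= _ + X)%R](divff (negbT (gt_eqF s0))) -mulrDl.
  rewrite ler_pM2r ?invr_gt0//.
  have /andP[_ Pxi] := Px i.
  by lra.
have /andP[tl tu] := ceil_itv (t0 i).
case: (ltP (Num.ceil (t0 i))%:~R (dyadic_pos k x i)) => /= tx; apply/andP.
  by rewrite addrK intrD; split=> //; lra.
by rewrite addr0; split=> //; lra.
Qed.

End Dyadic.

(** * The integral over a level set *)

Lemma le_esum_subset (R : realType) (T : choiceType) (A B : set T)
    (a : T -> \bar R) : A `<=` B -> (forall t, 0 <= a t) ->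
  \esum_(t in A) a t <= \esum_(t in B) a t.
Proof.
move=> AB a0; rewrite esum_mkcond [leRHS]esum_mkcond; apply: le_esum => t _.
by case: ifPn => [/set_mem/AB Bt|_]; [rewrite mem_set|case: ifP].
Qed.

Lemma le_esum_image (R : realType) (T T' : choiceType) (I : set T)
    (c : T -> T') (a : T' -> \bar R) : (forall t, 0 <= a t) ->
  \esum_(s in c @` I) a s <= \esum_(t in I) a (c t).
Proof.
move=> a0; have [->|/set0P[t0 It0]] := eqVneq I set0.
  by rewrite image_set0 !esum_set0.
have /choice[g gP] : forall s, exists t, (c @` I) s -> I t /\ c t = s.
  by move=> s; have [[t It <-]|] := pselect ((c @` I) s); [exists t|exists t0].
have -> : \esum_(s in c @` I) a s = \esum_(s in c @` I) a (c (g s)).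
  by apply: eq_esum => s /gP[_ ->].
rewrite -(esum_image (c @` I) g (fun t => a (c t))); last first.
  by move=> s s' /set_mem/gP[_ {2}<-] /set_mem/gP[_ {2}<-] ->.
by apply: le_esum_subset => // _ [s /gP[Is _] <-].
Qed.

Lemma esum_const_fin (R : realType) (T : finType) (c : R) : (0 <= c)%R ->
  \esum_(t in [set: T]) c%:E = (#|T|%:R * c)%:E.
Proof.
move=> c0; rewrite (esum_fset (@finite_finset T setT))//.
have -> : [set: T] = [set` enum T].
  by apply/seteqP; split=> // t _; rewrite /= mem_enum.
rewrite -fsbig_seq ?enum_uniq// big_enum/= sumEFin sumr_const.
by rewrite mulr_natl.
Qed.

Section Average.
Context {R : realType} {n : nat} (delta : R) (w : 'rV[R]_n -> \bar R).
Local Notation choquet := (@choquet R n delta).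
Local Notation vol Q := (edge Q `^ delta)%R.

(** The average as a real number; it is the intended one when the integral is
    finite. *)
Definition cavg (P : cube R n) : R := (fine (choquet (cube_set P) w) / vol P)%R.

Lemma eq_cavg P Q : cube_set P = cube_set Q -> edge P = edge Q ->
  cavg P = cavg Q.
Proof. by rewrite /cavg => -> ->. Qed.

Lemma vol_gt0 (P : cube R n) : (0 < vol P)%R.
Proof. exact/powR_gt0/edge_gt0. Qed.

Lemma choquet_cavg P : choquet (cube_set P) w < +oo ->
  choquet (cube_set P) w = (cavg P * vol P)%:E.
Proof.
move=> fin; rewrite /cavg divfK ?gt_eqF ?vol_gt0// fineK//.
by rewrite ge0_fin_numE ?choquet_ge0.
Qed.

End Average.

(** In a cube over which the average of [w] exceeds [lam], at least half of the
    content lies above the level [alpha * lam], by [w_large]. This allows such cubes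
    to be charged to any covering of the set above that level. *)
Section LevelSet.
Context {R : realType} {n : nat} (delta alpha : R) (w : 'rV[R]_n -> \bar R).
Local Notation H := (@hcontent R n delta).
Local Notation choquet := (@choquet R n delta).
Local Notation vol Q := (edge Q `^ delta)%R.
Local Notation cavg := (cavg delta w).

Hypotheses (delta_gt0 : (0 < delta)%R) (alpha_ge0 : (0 <= alpha)%R)
  (alpha_le1 : (alpha <= 1)%R).
Hypothesis w_fin : forall P : cube R n, choquet (cube_set P) w < +oo.
Hypothesis w_large : forall P : cube R n, (vol P)%:E <=
  2%:E * H [set x | cube_set P x /\ (alpha * cavg P)%:E < w x].

Variables (Q : cube R n) (lam : R).
Hypotheses (lam_gt0 : (0 < lam)%R) (Qlam : (cavg Q <= lam)%R).

Let A := [set x | cube_set Q x /\ (alpha * lam)%:E < w x].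
Let T := (nat * {ffun 'I_n -> int})%type.
Let cell (t : T) := dyadic_cell Q t.1 t.2.
Let bad (t : T) := (lam < cavg (cell t))%R.

Let maxbad : set T := [set t | [/\ bad t, cube_set (cell t) `&` A !=set0 &
  forall s, (s.1 < t.1)%N -> cube_set (cell t) `<=` cube_set (cell s) -> ~~ bad s]].

Let sub_cell (s t : T) x : (s.1 <= t.1)%N ->
  cube_set (cell s) x -> cube_set (cell t) x ->
  cube_set (cell t) `<=` cube_set (cell s).
Proof. exact: dyadic_cell_sub. Qed.

Let cell0 : cube_set (cell (0%N, [ffun=> 1%R])) = cube_set Q.
Proof. exact: dyadic_cell0. Qed.

Let maxbad_sub t : maxbad t -> (0 < t.1)%N /\ cube_set (cell t) `<=` cube_set Q.
Proof.
move=> [badt [x [tx [Qx _]]] maxt].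
have tQ : cube_set (cell t) `<=` cube_set Q.
  by rewrite -cell0; apply: (@sub_cell _ _ x) => //; rewrite cell0.
split=> //; rewrite lt0n; apply/eqP => t0.
move: badt; rewrite /bad ltNge => /negP; apply.
suff -> : cavg (cell t) = cavg Q by [].
have Qt : cube_set Q `<=` cube_set (cell t).
  by rewrite -cell0; apply: (@sub_cell _ _ x); rewrite ?t0 ?cell0.
apply: eq_cavg; first exact/seteqP.
by rewrite /cell/= t0 expr0 divr1.
Qed.

(* The parent of a maximal bad cell is not bad, which bounds the integral over it;
   passing to the parent costs the factor [2 `^ delta]. *)
Let choquet_maxbad t : maxbad t ->
  choquet (cube_set (cell t)) w <= (lam * (2 `^ delta * vol (cell t)))%:E.
Proof.
move=> mt; have [t0 _] := maxbad_sub mt.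
have [badt [x [tx [Qx _]]] maxt] := mt.
pose s : T := (t.1.-1, dyadic_index Q t.1.-1 x).
have sx : cube_set (cell s) x by apply/mem_dyadic_cell.
have ts : cube_set (cell t) `<=` cube_set (cell s).
  by apply: (@sub_cell _ _ x) => //=; exact: leq_pred.
have : ~~ bad s by apply: maxt => //=; rewrite prednK.
rewrite /bad -leNgt => slam.
apply: (le_trans (le_choquet _ ts (fun _ _ => lexx _))).
rewrite choquet_cavg// lee_fin (_ : vol (cell s) = 2 `^ delta * vol (cell t))%R; last first.
  rewrite -powRM ?ltW ?edge_gt0//; congr (_ `^ _)%R.
  rewrite /cell/= -[in RHS](prednK t0) exprS; field.
  by rewrite expf_neq0.
by rewrite ler_wpM2r// mulr_ge0 ?powR_ge0.
Qed.

Section Cover.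
Variable S : set T.
Hypothesis A_cover : A `<=` \bigcup_(s in S) cube_set (cell s).

(* The covering [S] of [A] is modified: cells of average at most [lam] are kept (the
   set [G]), and what lies in a maximal bad cell is replaced by this maximal bad
   cell, unless a coarser cell of [S] contains it. *)
Let B : set T := maxbad `&`
  [set t | forall s, S s -> (s.1 < t.1)%N -> ~ cube_set (cell t) `<=` cube_set (cell s)].
Let G : set T := [set s | S s /\ ~~ bad s].

(* A point of [A] lies in a cell [s] of the covering. If neither [s] nor an ancestor
   is bad, [s] itself is kept. Otherwise the coarsest bad cell around the point is
   maximal bad: it belongs to [B], unless it lies inside a coarser cell of the
   covering, which then cannot be bad and is kept. *)
Let GB_cover : A `<=` \bigcup_(s in G) cube_set (cell s) `|`
  \bigcup_(t in B) cube_set (cell t).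
Proof.
move=> x Ax; have [s Ss sx] := A_cover Ax.
pose c k : T := (k, dyadic_index Q k x).
have cx k : cube_set (cell (c k)) x by apply/mem_dyadic_cell.
have [[k ks bk]|good] := pselect (exists2 k, (k <= s.1)%N & bad (c k)); last first.
  left; exists s => //; split=> //; apply/negP => bs; apply: good.
  have cs : c s.1 = s.
    by move: sx; rewrite /c; case: (s) => k m /= /mem_dyadic_cell ->.
  by exists s.1; rewrite ?cs.
have exk : exists k, bad (c k) by exists k.
have [j bj jmin] := ex_minnP exk.
have mj : maxbad (c j).
  split=> //; first by exists x.
  move=> s' /= s'j js'; apply/negP => bs'.
  have : bad (c s'.1).
    rewrite (_ : c s'.1 = s')//; have /mem_dyadic_cell := js' _ (cx j).
    by rewrite /c; case: (s') => k' m /= ->.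
  by move=> /jmin; rewrite leqNgt s'j.
have [Bj|nBj] := pselect (B (c j)); first by right; exists (c j).
have [s' [Ss' s'j js']] : exists s', [/\ S s', (s'.1 < (c j).1)%N &
    cube_set (cell (c j)) `<=` cube_set (cell s')].
  apply: contrapT => no; apply: nBj; split=> // s' Ss' s'j js'.
  by apply: no; exists s'.
left; exists s'; last exact: js'.
by split=> //; case: mj => _ _; apply.
Qed.

(* Of two distinct intersecting cells one would be inside the other, against
   maximality. *)
Let B_disjoint t t' x : B t -> B t' ->
  cube_set (cell t) x -> cube_set (cell t') x -> t = t'.
Proof.
wlog tt' : t t' / (t.1 <= t'.1)%N => [wl|] Bt Bt' tx t'x.
  by case/orP: (leq_total t.1 t'.1) => le; [|apply/esym]; exact: wl.
have sub : cube_set (cell t') `<=` cube_set (cell t) by exact: sub_cell tx t'x.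
move: tt'; rewrite leq_eqVlt => /predU1P[tt'|tt']; last first.
  case: Bt' => -[_ _ maxt'] _; have := maxt' _ tt' sub.
  by case: Bt => -[-> ].
move: tx t'x => /mem_dyadic_cell tx /mem_dyadic_cell t'x.
by case: (t) (t') tt' tx t'x => k m [k' m'] /= -> -> ->.
Qed.

(* No coarser cell of [S] contains [t], so the cells of [S] that meet [A] within [t]
   lie inside [t]. They cover the part of [t] where [w] exceeds [alpha] times its
   average, which exceeds [alpha * lam] as [t] is bad. *)
Let vol_B t : B t -> (vol (cell t))%:E <=
  2%:E * \esum_(s in [set s | [/\ S s, cube_set (cell s) `&` A !=set0 &
    cube_set (cell s) `<=` cube_set (cell t)]]) (vol (cell s))%:E.
Proof.
move=> [mt tB]; apply: (le_trans (w_large (cell t))).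
apply: lee_wpmul2l; first by rewrite lee_fin.
apply: hcontent_le_cover => x [tx wx].
have [_ tQ] := maxbad_sub mt.
have Ax : A x.
  split; first exact: tQ.
  apply: le_lt_trans wx; rewrite lee_fin.
  case: mt => /ltW le _ _.
  exact: ler_wpM2l.
have [s Ss sx] := A_cover Ax.
exists s => //; split=> //; first by exists x.
have [lts|les] := ltnP s.1 t.1; last exact: sub_cell tx sx.
case: (tB _ Ss lts).
by apply: sub_cell sx tx; exact: ltnW.
Qed.

(* Each cell of [S] meeting [A] is inside at most one cell of [B], so no volume is
   counted twice. This replaces the additivity which the content lacks. *)
Let sum_vol_B : \esum_(t in B) (vol (cell t))%:E <=
  2%:E * \esum_(s in S) (vol (cell s))%:E.
Proof.
pose J t := [set s | [/\ S s, cube_set (cell s) `&` A !=set0 &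
    cube_set (cell s) `<=` cube_set (cell t)]].
have vol0 s : 0 <= (vol (cell s))%:E by rewrite lee_fin powR_ge0.
apply: le_trans (le_esum vol_B) _.
rewrite esumZl//; last by move=> t _; exact: esum_ge0.
apply: lee_wpmul2l; first by rewrite lee_fin.
rewrite (@esum_esum _ _ _ B J (fun _ s => (vol (cell s))%:E))//.
rewrite -(esum_image (B `*`` J) snd (fun s => (vol (cell s))%:E)); last first.
  move=> [t s] [t' s'] /set_mem[/= Bt [_ [x [sx _]] st]] /set_mem[/= Bt' [_ _ s't']] ss'.
  rewrite -ss' in s't' *; congr (_, _).
  by apply: (@B_disjoint _ _ x) => //; [exact: st|exact: s't'].
apply: le_esum_subset => // _ [[t s] [_ [Ss _ _]] <-].
exact: Ss.
Qed.

(** The modified covering consists of cells over which the average of [w] is at most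
    a constant times [lam], at a total cost comparable with that of [S]. *)
Lemma choquet_level_le_cover : choquet [set x | cube_set Q x /\ lam%:E < w x] w <=
  (lam * (1 + 2 * 2 `^ delta))%:E * \esum_(s in S) (vol (cell s))%:E.
Proof.
have vol0 s : 0 <= (vol (cell s))%:E by rewrite lee_fin powR_ge0.
apply: (@le_trans _ _ (choquet (\bigcup_(s in G) cube_set (cell s) `|`
    \bigcup_(t in B) cube_set (cell t)) w)).
  apply: le_choquet => // x [Qx wx]; apply: GB_cover; split=> //.
  apply: le_lt_trans wx; rewrite lee_fin -[leRHS]mul1r ler_wpM2r// ltW//.
apply: (le_trans (choquetU _ _ _ _)).
have G_le : choquet (\bigcup_(s in G) cube_set (cell s)) w <=
    lam%:E * \esum_(s in S) (vol (cell s))%:E.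
  apply: (le_trans (@choquet_subadditive _ _ delta _ G (fun s => cube_set (cell s)) _ w (@subset_refl _ _))).
  rewrite -esumZl//; last exact: ltW.
  apply: (@le_trans _ _ (\esum_(s in G) (lam%:E * (vol (cell s))%:E))).
    apply: le_esum => s [_]; rewrite /bad -leNgt => le.
    by rewrite choquet_cavg// -EFinM lee_fin ler_wpM2r// powR_ge0.
  apply: le_esum_subset => [s []//|s].
  by rewrite -EFinM lee_fin mulr_ge0 ?powR_ge0// ltW.
have B_le : choquet (\bigcup_(t in B) cube_set (cell t)) w <=
    (lam * 2 `^ delta)%:E * (2%:E * \esum_(s in S) (vol (cell s))%:E).
  have c0 : (0 <= lam * 2 `^ delta)%R by rewrite mulr_ge0 ?powR_ge0// ltW.
  apply: (le_trans (@choquet_subadditive _ _ delta _ B (fun s => cube_set (cell s)) _ w (@subset_refl _ _))).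
  apply: (@le_trans _ _ (\esum_(t in B) ((lam * 2 `^ delta)%:E * (vol (cell t))%:E))).
    apply: le_esum => t [mt _]; rewrite -EFinM -mulrA.
    exact: choquet_maxbad.
  by rewrite esumZl// lee_wpmul2l.
apply: le_trans (leeD G_le B_le) _.
rewrite muleA -EFinM -ge0_muleDl ?lee_fin ?mulr_ge0 ?powR_ge0 ?(ltW lam_gt0)//.
rewrite -EFinD le_eqVlt; apply/orP; left; apply/eqP; congr (_%:E * _).
by ring.
Qed.

End Cover.

(** The factor [2 ^+ n * 2 `^ delta] is the cost of making a covering dyadic, and
    [1 + 2 * 2 `^ delta] is that of modifying it. *)
Definition level_constant : R := (2 ^+ n * 2 `^ delta * (1 + 2 * 2 `^ delta))%R.

Lemma choquet_level_le :
  choquet [set x | cube_set Q x /\ lam%:E < w x] w <=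
  (level_constant * lam)%:E * H [set x | cube_set Q x /\ (alpha * lam)%:E < w x].
Proof.
have C0 : (0 < level_constant * lam)%R.
  apply: mulr_gt0 => //; rewrite /level_constant; apply: mulr_gt0.
    by rewrite mulr_gt0 ?exprn_gt0 ?powR_gt0.
  by rewrite ltr_pwDl// mulr_ge0 ?powR_ge0.
rewrite -lee_pdivrMl//; apply: le_ereal_inf_tmp => _ [D [P [AP ->]]].
rewrite lee_pdivrMl//.
have /choice[k /choice[F kF]] := fun i => dyadic_cover Q (P i).
pose c (ib : nat * {ffun 'I_n -> bool}) : T := (k ib.1, F ib.1 ib.2).
pose I : set (nat * {ffun 'I_n -> bool}) := D `*` setT.
have vol0 s : 0 <= (vol (cell s))%:E by rewrite lee_fin powR_ge0.
have cov : A `<=` \bigcup_(s in c @` I) cube_set (cell s).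
  move=> x [Qx wx]; have [i Di Pix] := AP x (conj Qx wx).
  have [_ /(_ x (conj Qx Pix))[b _ bx]] := kF i.
  by exists (c (i, b)) => //; exists (i, b).
apply: (le_trans (choquet_level_le_cover cov)).
have sumI : \esum_(s in c @` I) (vol (cell s))%:E <=
    (2 ^+ n * 2 `^ delta)%:E * \esum_(i in D) (vol (P i))%:E.
  apply: (le_trans (le_esum_image _ _ _)) => //.
  rewrite -(@esum_esum _ _ _ D (fun=> setT) (fun i b => (vol (cell (c (i, b))))%:E))//.
  rewrite -esumZl; first last.
  - by move=> i _; rewrite lee_fin powR_ge0.
  - by rewrite mulr_ge0 ?powR_ge0// exprn_ge0.
  apply: le_esum => i _.
  apply: (@le_trans _ _ (\esum_(b in [set: {ffun 'I_n -> bool}])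
      (2 `^ delta * vol (P i))%:E)).
    apply: le_esum => b _; rewrite lee_fin -powRM ?(ltW (edge_gt0 _))//.
    rewrite ge0_ler_powR ?nnegrE ?mulr_ge0 ?(ltW (edge_gt0 _)) ?(ltW delta_gt0)//.
    exact: (kF i).1.
  rewrite esum_const_fin ?mulr_ge0 ?powR_ge0// -EFinM lee_fin.
  by rewrite card_ffun card_bool card_ord natrX mulrA.
apply: le_trans (lee_wpmul2l _ sumI) _.
  by rewrite lee_fin mulr_ge0 ?(ltW lam_gt0)// addr_ge0// mulr_ge0// powR_ge0.
rewrite muleA -EFinM le_eqVlt; apply/orP; left; apply/eqP; congr (_%:E * _).
by rewrite /level_constant; ring.
Qed.

End LevelSet.

(** * The reverse Hoelder inequality *)

(** A sequence whose tails are controlled by its terms decays geometrically: if [t]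
    is the sum of the terms after the next one, [t <= C * u i] gives
    [(1 + C) * t <= C * (u i + t)], so each two steps gain a factor
    [C / (1 + C)]. Only finite sums are used, so that no summability is needed. *)
Lemma tail_decay (R : realFieldType) (u : nat -> R) (C V r : R) :
  (0 < C)%R -> (0 <= V)%R -> (0 < r <= 1)%R -> (C / (1 + C) <= r ^+ 2)%R ->
  (forall j, 0 <= u j)%R ->
  (forall i N, \sum_(j < N) u (i + j.+2)%N <= C * u i)%R ->
  (forall N, \sum_(j < N) u j <= V)%R ->
  forall i N, (\sum_(j < N) u (i + j)%N <= V * r ^+ i / r)%R.
Proof.
move=> C0 V0 /andP[r0 r1] Cr u0 uC uV i.
have VrV : (V <= V / r)%R by rewrite ler_peMr// invf_ge1.
suff [//] : (forall N, \sum_(j < N) u (i + j)%N <= V * r ^+ i / r)%R /\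
  (forall N, \sum_(j < N) u (i.+1 + j)%N <= V * r ^+ i.+1 / r)%R.
elim: i => [|i [IH IH1]]; split=> // N.
- by rewrite expr0 mulr1; apply: le_trans VrV; exact: uV.
- rewrite expr1 mulfK ?gt_eqF//; apply: le_trans (uV N.+1).
  rewrite big_ord_recl/= -[leLHS]add0r lerD//.
set t := (\sum_(j < N) u (i.+2 + j)%N)%R.
have tE : t = (\sum_(j < N) u (i + j.+2)%N)%R.
  by apply: eq_bigr => j _; rewrite addSnnS addSnnS.
have tC : (t <= C * u i)%R by rewrite tE.
have tI : (u i + t <= V * r ^+ i / r)%R.
  apply: le_trans (IH N.+2); rewrite !big_ord_recl/= addn0 tE.
  rewrite lerD2l -[leLHS]add0r lerD//.
have t_le : (t <= C / (1 + C) * (V * r ^+ i / r))%R.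
  rewrite mulrAC ler_pdivlMr ?addr_gt0//.
  apply: (@le_trans _ _ (C * (u i + t))%R); last by rewrite ler_pM2l.
  by lra.
apply: (le_trans t_le).
rewrite (_ : V * r ^+ i.+2 / r = r ^+ 2 * (V * r ^+ i / r))%R.
  by rewrite ler_wpM2r// !mulr_ge0// ?invr_ge0 ?exprn_ge0// ltW.
by rewrite -addn2 exprD; ring.
Qed.

Lemma nneseries_le_geometric (R : realType) (f : nat -> \bar R) (c q : R) :
  (0 <= c)%R -> (0 < q < 1)%R -> (forall j, 0 <= f j <= (c * q ^+ j)%:E) ->
  \sum_(j <oo) f j <= (c / (1 - q))%:E.
Proof.
move=> c0 /andP[q0 q1] fP.
have f0 j : 0 <= f j by case/andP: (fP j).
apply: lime_le; first exact: is_cvg_nneseries.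
apply: nearW => N.
apply: (@le_trans _ _ (\sum_(0 <= j < N) (c * q ^+ j)%:E)).
  by apply: lee_sum => j _; case/andP: (fP j).
rewrite sumEFin lee_fin; apply: (geometric_le_lim N) => //.
by rewrite ger0_norm// ltW.
Qed.

Section ReverseHoelder.
Context {R : realType} {n : nat} (delta alpha : R) (w : 'rV[R]_n -> \bar R).
Local Notation H := (@hcontent R n delta).
Local Notation choquet := (@choquet R n delta).
Local Notation vol Q := (edge Q `^ delta)%R.
Local Notation cavg := (cavg delta w).

Hypotheses (delta_gt0 : (0 < delta)%R) (alpha_gt0 : (0 < alpha)%R)
  (alpha_le2 : (alpha <= 2^-1)%R).
Hypothesis w_ge0 : forall x, 0 <= w x.
Hypothesis w_fin : forall P : cube R n, choquet (cube_set P) w < +oo.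
Hypothesis cavg_gt0 : forall P, (0 < cavg P)%R.
Hypothesis w_large : forall P : cube R n, (vol P)%:E <=
  2%:E * H [set x | cube_set P x /\ (alpha * cavg P)%:E < w x].

Let b := alpha^-1%R.
Let b_ge2 : (2 <= b)%R.
Proof. by rewrite -[leLHS]invrK lef_pV2 ?posrE ?invr_gt0. Qed.
Let b_gt0 : (0 < b)%R. Proof. by rewrite invr_gt0. Qed.

Let C1 : R := @level_constant R n delta.
Let C1_gt0 : (0 < C1)%R.
Proof.
rewrite /C1 /level_constant; apply: mulr_gt0.
  by rewrite mulr_gt0 ?exprn_gt0 ?powR_gt0.
by rewrite ltr_pwDl// mulr_ge0 ?powR_ge0.
Qed.

Let C2 := (2 * C1 * b)%R.
Let C2_gt0 : (0 < C2)%R. Proof. by rewrite !mulr_gt0. Qed.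

(* Any [r < 1] with [C2 / (1 + C2) <= r ^ 2] is a rate of decay. *)
Let r : R := ((1 + C2 / (1 + C2)) / 2)%R.
Let q : R := ((1 + r) / 2)%R.

Let rate_bounds : [/\ (0 < r)%R, (r < 1)%R & (C2 / (1 + C2) <= r ^+ 2)%R].
Proof.
have p0 : (0 < C2 / (1 + C2))%R by rewrite divr_gt0// addr_gt0.
have p1 : (C2 / (1 + C2) < 1)%R by rewrite ltr_pdivrMr ?addr_gt0// mul1r ltrDr.
rewrite /r; set p := (C2 / (1 + C2))%R in p0 p1 *.
split; [by lra|by lra|].
have := sqr_ge0 (1 - p)%R; rewrite expr2 => ?; rewrite expr2.
by nra.
Qed.

(* Chosen so that [b `^ gamma0 * r <= q < 1]: the weight [b `^ (gamma * j)] is then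
   still summable against the decay [r ^+ j]. *)
Let gamma0 : R := Num.min (2^-1)%R (ln (q / r) / ln b)%R.
Let Crh : R := (1 + (b ^+ 2 * 3 / r) / (1 - q))%R.

Let gamma0_gt0 : (0 < gamma0)%R.
Proof.
have [r0 r1 _] := rate_bounds.
rewrite lt_min invr_gt0 ltr0n/= divr_gt0//; apply: ln_gt0.
  by rewrite ltr_pdivlMr// mul1r /q; lra.
by apply: lt_le_trans b_ge2; rewrite ltr1n.
Qed.

Let powR_gamma gamma : (gamma <= gamma0)%R -> (b `^ gamma * r <= q)%R.
Proof.
have [r0 r1 _] := rate_bounds.
have lnb : (0 < ln b)%R by apply: ln_gt0; apply: lt_le_trans b_ge2; rewrite ltr1n.
rewrite le_min => /andP[_]; rewrite ler_pdivlMr// => le.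
rewrite -ler_pdivlMr// /powR gt_eqF//.
have qr0 : (0 < q / r)%R by rewrite divr_gt0// /q; lra.
by rewrite -[leRHS]lnK ?posrE// ler_expR.
Qed.

Section OneCube.
Variable P : cube R n.
Let a := cavg P.
Let a_gt0 : (0 < a)%R. Proof. exact: cavg_gt0. Qed.
Let ab_gt0 j : (0 < a * b ^+ j)%R.
Proof. by rewrite mulr_gt0 ?exprn_gt0. Qed.

(* The content of the part of [P] above level [a * b ^+ j]. As [b] is the inverse of
   [alpha], the key estimate relates each such level to the preceding one. *)
Let phi j : R := fine (H [set x | cube_set P x /\ (a * b ^+ j)%:E < w x]).
Let phiE j : H [set x | cube_set P x /\ (a * b ^+ j)%:E < w x] = (phi j)%:E.
Proof.
rewrite /phi fineK// ge0_fin_numE ?hcontent_ge0//.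
apply: (@le_lt_trans _ _ (H (cube_set P))); first by apply: le_hcontent => x [].
by apply: le_lt_trans (hcontent_cube_le delta P) _; rewrite ltry.
Qed.
Let phi_ge0 j : (0 <= phi j)%R.
Proof. by rewrite -lee_fin -phiE hcontent_ge0. Qed.
Let phi_le j : (phi j <= vol P)%R.
Proof.
rewrite -lee_fin -phiE; apply: le_trans (hcontent_cube_le delta P).
by apply: le_hcontent => x [].
Qed.

(* Up to a constant, [a * u j] bounds the contribution to the integral of [w] of the
   levels between [a * b ^+ j] and [a * b ^+ j.+1]. *)
Let u j : R := (b ^+ j * phi j)%R.
Let u_ge0 j : (0 <= u j)%R.
Proof. by rewrite mulr_ge0// exprn_ge0// ltW. Qed.

(* Riemann sums of the part of the integral above level [a * b ^+ k]. *)
Let level_sum k N : (a * \sum_(j < N) u (k + j.+1)%N)%:E <=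
  2%:E * choquet [set x | cube_set P x /\ (a * b ^+ k)%:E < w x] w.
Proof.
pose s j : R := (a * b ^+ (k + j))%R.
have s0 j : (0 <= s j)%R by exact/ltW/ab_gt0.
have b1 : (1 <= b)%R by apply: le_trans b_ge2; rewrite ler1n.
have sS j : (s j <= s j.+1)%R.
  by rewrite /s addnS ler_pM2l// ler_weXn2l.
have := @choquet_ge_sum _ _ delta
  [set x | cube_set P x /\ (a * b ^+ k)%:E < w x] w s N (s0 0%N) sS.
move=> le; rewrite -lee_pdivrMl//; apply: le_trans le.
rewrite -EFinM mulrA mulr_sumr -sumEFin; apply: lee_sum => j _.
apply: (@le_trans _ _ ((s j.+1 - s j)%:E * (phi (k + j.+1)%N)%:E)).
  rewrite -EFinM lee_fin /u mulrA ler_wpM2r// /s addnS exprS.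
  have z0 := ab_gt0 (k + j)%N; set z := (b ^+ (k + j))%R in z0 *.
  rewrite (_ : 2^-1 * a * (b * z) = 2^-1 * b * (a * z))%R; last by ring.
  rewrite (_ : a * (b * z) - a * z = (b - 1) * (a * z))%R; last by ring.
  by rewrite ler_wpM2r ?(ltW z0)//; move: b_ge2; lra.
apply: lee_wpmul2l; first by rewrite lee_fin subr_ge0.
rewrite -phiE; apply: le_hcontent => x [Px wx]; split; last exact: ltW.
split=> //; apply: le_lt_trans wx; rewrite lee_fin ler_pM2l//.
by rewrite ler_weXn2l// leq_addr.
Qed.

Let sum_u_le N : (\sum_(j < N) u j <= 3 * vol P)%R.
Proof.
case: N => [|N]; first by rewrite big_ord0 mulr_ge0// powR_ge0.
rewrite big_ord_recl/=.
have u0 : (u 0%N <= vol P)%R by rewrite /u expr0 mul1r.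
suff : (\sum_(j < N) u j.+1 <= 2 * vol P)%R.
  under [X in (_ + X <= _)%R]eq_bigr do rewrite /bump/= add1n.
  by lra.
have := level_sum 0 N.
have : choquet [set x | cube_set P x /\ (a * b ^+ 0)%:E < w x] w <= (a * vol P)%:E.
  by rewrite -choquet_cavg//; apply: le_choquet => // x [].
move=> le1 le2; have := le_trans le2 (lee_wpmul2l _ le1).
rewrite lee_fin => /(_ (ler0n R 2)); rewrite -EFinM lee_fin.
by rewrite mulrCA ler_pM2l.
Qed.

(* The key estimate at level [a * b ^+ i.+1]. *)
Let tail_u i N : (\sum_(j < N) u (i + j.+2)%N <= C2 * u i)%R.
Proof.
have := level_sum i.+1 N.
have lev : choquet [set x | cube_set P x /\ (a * b ^+ i.+1)%:E < w x] w <=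
    (C1 * (a * b ^+ i.+1) * phi i)%:E.
  rewrite (EFinM _ (phi i)) -phiE.
  rewrite (_ : (a * b ^+ i)%:E = (alpha * (a * b ^+ i.+1))%:E); last first.
    congr (_%:E); have ab1 : (alpha * b = 1)%R by rewrite mulfV ?gt_eqF.
    by rewrite exprS -[LHS]mul1r -ab1; ring.
  apply: choquet_level_le => //; first exact: ltW.
    by apply: le_trans alpha_le2 _; rewrite invf_le1// ler1n.
  rewrite ler_peMr ?(ltW a_gt0)// exprn_ege1//.
  by apply: le_trans b_ge2; rewrite ler1n.
move=> le2; have := le_trans le2 (lee_wpmul2l _ lev).
rewrite lee_fin => /(_ (ler0n R 2)); rewrite -EFinM lee_fin.
under eq_bigr do rewrite addSnnS.
rewrite (_ : 2 * (C1 * (a * b ^+ i.+1) * phi i) = a * (C2 * u i))%R.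
  by rewrite ler_pM2l.
by rewrite /C2 /u exprS; ring.
Qed.

Let decay j : (u j <= 3 * vol P * r ^+ j / r)%R.
Proof.
have [r0 r1 r2] := rate_bounds.
have V0 : (0 <= 3 * vol P)%R by rewrite mulr_ge0// powR_ge0.
have := @tail_decay R u C2 _ r C2_gt0 V0 _ r2 u_ge0 tail_u sum_u_le j 1%N.
by rewrite big_ord1 addn0; apply; rewrite r0 ltW.
Qed.

Lemma reverse_hoelder_cube gamma : (0 < gamma <= gamma0)%R ->
  choquet (cube_set P) (fun x => poweR (w x) (1 + gamma)) <=
  (Crh * cavg P `^ (1 + gamma) * vol P)%:E.
Proof.
move=> /andP[g0 gg0]; have [r0 r1 _] := rate_bounds.
have g1 : (gamma <= 1)%R.
  apply: (le_trans gg0); apply: (@le_trans _ _ 2^-1%R); first by rewrite ge_min lexx.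
  by rewrite invf_le1// ler1n.
have b1 : (1 <= b)%R by apply: le_trans b_ge2; rewrite ler1n.
pose s j := ((a * b ^+ j) `^ (1 + gamma))%R.
have sS j : (s j <= s j.+1)%R.
  rewrite ge0_ler_powR ?nnegrE ?(ltW (ab_gt0 _)) ?addr_ge0// ?(ltW g0)//.
  by rewrite ler_pM2l// ler_weXn2l.
have sy t : exists j, (t <= s j)%R.
  pose z := (Num.max (1 : R) t / a)%R.
  exists (Num.bound z).
  have zb : (Num.max (1 : R) t <= a * b ^+ Num.bound z)%R.
    rewrite mulrC -ler_pdivrMr//; apply: (@le_trans _ _ (2 ^+ Num.bound z)%R).
      by rewrite ltW// upper_nthrootP.
    by rewrite lerXn2r ?nnegrE// ltW.
  move: zb; rewrite ge_max => /andP[zb1 zbt]; apply: (le_trans zbt).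
  by apply: le1r_powR => //; rewrite lerDl ltW.
have := @choquet_le_sum _ _ delta (cube_set P) (fun x => poweR (w x) (1 + gamma)) s
  (powR_ge0 _ _) sS sy.
move=> /le_trans; apply.
pose c := (a `^ (1 + gamma) * vol P * (b ^+ 2 * 3 / r))%R.
have c0 : (0 <= c)%R.
  rewrite /c; apply: mulr_ge0; first by rewrite mulr_ge0 ?powR_ge0.
  by rewrite divr_ge0 ?(ltW r0)// mulr_ge0 ?exprn_ge0// ltW.
have q01 : (0 < q < 1)%R by rewrite /q; apply/andP; split; lra.
apply: (@le_trans _ _ ((a `^ (1 + gamma) * vol P)%:E + (c / (1 - q))%:E)); last first.
  by rewrite -EFinD lee_fin /c /Crh -/a le_eqVlt; apply/orP; left; apply/eqP; ring.
apply: leeD.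
  rewrite EFinM /s expr0 mulr1; apply: lee_wpmul2l; first by rewrite lee_fin powR_ge0.
  exact: hcontent_cube_le.
apply: nneseries_le_geometric => // j; apply/andP; split.
  by rewrite mule_ge0 ?hcontent_ge0// lee_fin subr_ge0.
apply: (@le_trans _ _ ((s j.+1)%:E * (phi j)%:E)).
  apply: lee_pmul; rewrite ?hcontent_ge0// ?lee_fin ?subr_ge0//.
    by rewrite gerBl powR_ge0.
  rewrite -phiE; apply: le_hcontent => x [Px]; split=> //.
  rewrite ltNge; apply/negP => wle.
  have : poweR (w x) (1 + gamma) <= (s j)%:E.
    rewrite /s -poweR_EFin; apply: gt0_ler_poweR => //.
    - by rewrite addr_ge0// ltW.
    - by rewrite in_itv/= w_ge0 leey.
    - by rewrite in_itv/= leey lee_fin ltW.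
  by rewrite leNgt => /negP.
rewrite -EFinM lee_fin.
have bg1 : (b `^ gamma <= b)%R by apply: ler1_powR.
(* One factor [b ^+ j] of the power [1 + gamma] makes [u j]; the exponent [gamma]
   leaves the geometric weight. *)
have sE : (s j.+1 * phi j =
    a `^ (1 + gamma) * (b * b `^ gamma) * ((b `^ gamma) ^+ j * u j))%R.
  have bS0 : (0 < b ^+ j.+1)%R by rewrite exprn_gt0.
  have powE : ((b ^+ j.+1) `^ (1 + gamma) = b ^+ j.+1 * (b `^ gamma) ^+ j.+1)%R.
    rewrite powRD; last by apply/implyP => _; rewrite gt_eqF.
    rewrite powRr1 ?(ltW bS0)// -(powR_mulrn j.+1 (ltW b_gt0)).
    rewrite -powRrM (mulrC j.+1%:R%R gamma) powRrM.
    by rewrite (powR_mulrn j.+1 (powR_ge0 b gamma)).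
  rewrite /s powRM ?(ltW a_gt0) ?(ltW bS0)// powE /u !exprS.
  by ring.
rewrite sE; apply: (@le_trans _ _
  (a `^ (1 + gamma) * (b * b) * (3 * vol P / r * q ^+ j)))%R; last first.
  by rewrite /c expr2 le_eqVlt; apply/orP; left; apply/eqP; ring.
apply: ler_pM.
- by rewrite !mulr_ge0 ?powR_ge0 ?(ltW b_gt0).
- by rewrite mulr_ge0 ?exprn_ge0 ?powR_ge0.
- by rewrite ler_wpM2l ?powR_ge0// ler_pM2l.
apply: (@le_trans _ _ ((b `^ gamma) ^+ j * (3 * vol P * r ^+ j / r)))%R.
  by rewrite ler_wpM2l ?exprn_ge0 ?powR_ge0.
rewrite (_ : (b `^ gamma) ^+ j * (3 * vol P * r ^+ j / r) =
  3 * vol P / r * (b `^ gamma * r) ^+ j)%R; last first.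
  by rewrite (exprMn j (b `^ gamma)%R r); ring.
rewrite ler_wpM2l// ?mulr_ge0 ?powR_ge0 ?invr_ge0 ?(ltW r0)//.
have q0 : (0 <= q)%R by case/andP: q01 => /ltW.
have br0 : (0 <= b `^ gamma * r)%R by rewrite mulr_ge0 ?powR_ge0// ltW.
by rewrite lerXn2r ?nnegrE// powR_gamma.
Qed.

End OneCube.

(** The exponent and the constant are uniform over cubes, and every smaller positive
    exponent is allowed: two weights can then be given a common exponent. *)
Theorem reverse_hoelder : exists g0 C : R, [/\ (0 < g0)%R, (0 < C)%R &
  forall gamma P, (0 < gamma <= g0)%R ->
  choquet (cube_set P) (fun x => poweR (w x) (1 + gamma)) <=
  (C * cavg P `^ (1 + gamma) * vol P)%:E].
Proof.
exists gamma0, Crh; split=> // [|gamma P]; last exact: reverse_hoelder_cube.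
have [r0 r1 _] := rate_bounds.
have c0 : (0 <= b ^+ 2 * 3 / r)%R.
  by rewrite divr_ge0 ?(ltW r0)// mulr_ge0 ?exprn_ge0// ltW.
by rewrite /Crh ltr_pwDl// divr_ge0// /q; lra.
Qed.

End ReverseHoelder.

(** * Averages of weights *)

Lemma poweR_le (R : realType) (x y : \bar R) (e : R) :
  (0 <= e)%R -> 0 <= x -> x <= y -> poweR x e <= poweR y e.
Proof.
move=> e0 x0 xy; apply: gt0_ler_poweR => //; rewrite in_itv/= leey andbT //.
exact: le_trans xy.
Qed.

Section Compact.
Context {R : realType} {n : nat}.

Lemma cube_sub_compact (Q : cube R n) :
  exists2 E : set 'rV[R]_n, compact E & cube_set Q `<=` E.
Proof.
exists [set v : 'rV[R]_n | forall i,
    `[corner Q ord0 i, (corner Q ord0 i + edge Q)%R]%classic (v ord0 i)].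
  apply: (@rV_compact _ _
    (fun i => `[corner Q ord0 i, (corner Q ord0 i + edge Q)%R]%classic)).
  by move=> i; exact: segment_compact.
by move=> x Qx i /=; rewrite in_itv/=; have /andP[/ltW -> ->] := Qx i.
Qed.

Lemma compact_sub_cube (E : set 'rV[R]_n) : compact E ->
  exists Q : cube R n, E `<=` cube_set Q.
Proof.
move=> /compact_bounded[M [_ EM]].
pose N : R := (`|M| + 1)%R.
have N0 : (0 < N + N)%R by rewrite addr_gt0// ltr_wpDl.
exists (Cube (const_mx (- (N + N))%R : 'rV[R]_n) (addr_gt0 N0 N0)) => x Ex i /=.
have xN : (`|x| <= N)%R.
  by apply: (EM N _ x Ex); rewrite (le_lt_trans (ler_norm M))// ltrDl.
have : (`|x ord0 i| <= N)%R.
  apply: le_trans xN.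
  have /mapP[j _ ->] : `|x ord0 i|%R \in [seq `|x y.1 y.2|%R | y : 'I_1 * 'I_n].
    by apply/mapP; exists (ord0, i) => //=; rewrite mem_enum.
  by rewrite [leRHS]/Num.Def.normr /= mx_normrE; apply/bigmax_geP; right => /=; exists j.
by rewrite mxE ler_norml => /andP[xl xu]; apply/andP; split; lra.
Qed.

End Compact.

Section Averages.
Context {R : realType} {n : nat} (delta : R).
Hypothesis delta_n : (0 < delta <= n%:R)%R.
Implicit Types (w : 'rV[R]_n -> \bar R) (P Q : cube R n).
Local Notation H := (@hcontent R n delta).
Local Notation choquet := (@choquet R n delta).
Local Notation vol Q := (edge Q `^ delta)%R.

Let delta_gt0 : (0 < delta)%R. Proof. by case/andP: delta_n. Qed.

Lemma cube_averageE w P :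
  cube_average delta P w = (vol P)^-1%:E * choquet (cube_set P) w.
Proof.
by rewrite /cube_average hcontent_cube// inver gt_eqF ?vol_gt0.
Qed.

Lemma cube_average_fin w P : choquet (cube_set P) w < +oo ->
  cube_average delta P w = (cavg delta w P)%:E.
Proof.
move=> fin; rewrite cube_averageE choquet_cavg// -EFinM mulrC mulfK// gt_eqF//.
exact: vol_gt0.
Qed.

Lemma cube_average_ge0 w P : 0 <= cube_average delta P w.
Proof.
by rewrite cube_averageE mule_ge0 ?choquet_ge0// lee_fin invr_ge0 powR_ge0.
Qed.

(** Since [E] is covered by the null set where [w] vanishes and by countably
    many superlevel sets, one of the latter has positive content. *)
Lemma choquet_gt0 (E : set 'rV[R]_n) w :
  0 < H E -> (forall x, 0 <= w x) -> H [set x | ~ 0 < w x] = 0 ->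
  0 < choquet E w.
Proof.
move=> HE w0 null; rewrite lt_neqAle choquet_ge0 andbT; apply/negP => /eqP c0.
have lev0 t : (0 < t)%R -> H [set x | E x /\ t%:E <= w x] = 0.
  move=> t0; apply/eqP; rewrite eq_le hcontent_ge0 andbT.
  by have := chebyshev delta E w (ltW t0); rewrite -c0 pmule_rle0 ?lte_fin.
have : H E <= 0; last by rewrite leNgt HE.
pose F m := [set x | E x /\ (m.+1%:R^-1 : R)%:E <= w x].
have EF : E `<=` [set x | ~ 0 < w x] `|` \bigcup_(m in setT) F m.
  move=> x Ex; have [wx|] := pselect (0 < w x); last by left.
  right; have [m mw] : exists m : nat, (m.+1%:R^-1 : R)%:E <= w x.
    case: (w x) wx => [r||]//; last by exists 0%N; rewrite leey.
    rewrite lte_fin => r0; exists (Num.bound r^-1); rewrite lee_fin invf_ple ?posrE//.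
    by apply: ltW; apply: (lt_trans (archi_boundP _)); rewrite ?invr_ge0 ?(ltW r0)// ltr_nat.
  by exists m.
apply: (le_trans (le_hcontent delta EF)); apply: (le_trans (hcontentU _ _ _)).
rewrite null add0e.
apply: (le_trans (@hcontent_subadditive _ _ delta _ setT F _ (@subset_refl _ _))).
by rewrite esum1// => m _; apply: lev0; rewrite invr_gt0.
Qed.

Lemma cavg_gt0 w P : (forall x, 0 <= w x) -> H [set x | ~ 0 < w x] = 0 ->
  choquet (cube_set P) w < +oo -> (0 < cavg delta w P)%R.
Proof.
move=> w0 null fin; rewrite /cavg divr_gt0 ?vol_gt0// fine_gt0// fin andbT.
by apply: choquet_gt0 => //; rewrite hcontent_cube// lte_fin vol_gt0.
Qed.

Lemma hcontent_sub0 (E F : set 'rV[R]_n) : E `<=` F -> H F = 0 -> H E = 0.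
Proof.
move=> EF F0; apply/eqP; rewrite eq_le hcontent_ge0 andbT -F0.
exact: le_hcontent.
Qed.

(** Where [w] is below [alpha] times its average, the dual weight [s] is large, and
    Chebyshev's inequality bounds the content of such a set by
    [alpha `^ e * K <= 2^-1] times that of the cube. Subadditivity leaves at least
    half the content to the set where [w] is larger. *)
Lemma dual_weight_large (w s : 'rV[R]_n -> \bar R) (e K : R) :
  (0 < e)%R -> (0 < K)%R ->
  (forall P, 0 < cavg delta w P)%R ->
  (forall P, choquet (cube_set P) s < +oo) ->
  (forall P, cavg delta w P `^ e * cavg delta s P <= K)%R ->
  (forall x t, (0 < t)%R -> w x <= t%:E -> (t `^ (- e))%:E <= s x) ->
  exists alpha : R, [/\ (0 < alpha)%R, (alpha <= 2^-1)%R &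
    forall P, (vol P)%:E <=
      2%:E * H [set x | cube_set P x /\ (alpha * cavg delta w P)%:E < w x]].
Proof.
move=> e0 K0 w0 sfin wsK dual.
(* This makes [alpha `^ e * K <= 2^-1]. *)
pose alpha : R := Num.min (2^-1)%R ((2 * K)^-1 `^ e^-1)%R.
have alpha0 : (0 < alpha)%R.
  by rewrite /alpha lt_min invr_gt0 ltr0n/= powR_gt0// invr_gt0 mulr_gt0.
exists alpha; split=> // [|P]; first by rewrite /alpha ge_min lexx.
have alphae : (alpha `^ e * K <= 2^-1)%R.
  have : (alpha `^ e <= ((2 * K)^-1 `^ e^-1) `^ e)%R.
    by rewrite ge0_ler_powR ?nnegrE ?powR_ge0 ?(ltW e0) ?(ltW alpha0)// /alpha ge_min lexx orbT.
  rewrite -powRrM mulVf ?gt_eqF// powRr1 ?invr_ge0 ?mulr_ge0 ?(ltW K0)// => le.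
  apply: (@le_trans _ _ ((2 * K)^-1 * K)%R); first by rewrite ler_pM2r.
  by rewrite invfM mulfVK// gt_eqF.
set t := (alpha * cavg delta w P)%R.
have t0 : (0 < t)%R by rewrite mulr_gt0.
pose S := [set x | cube_set P x /\ (t `^ (- e))%:E <= s x].
have S_le : H S <= (2^-1 * vol P)%:E.
  have := chebyshev delta (cube_set P) s (powR_ge0 t (- e)).
  rewrite choquet_cavg// -lee_pdivlMl ?powR_gt0// => /le_trans; apply.
  rewrite -EFinM lee_fin powRN invrK mulrA ler_wpM2r ?powR_ge0//.
  rewrite /t powRM ?(ltW alpha0) ?(ltW (w0 P))// -mulrA.
  by apply: le_trans alphae; rewrite ler_wpM2l ?powR_ge0.
have : (vol P)%:E <= H S + H [set x | cube_set P x /\ t%:E < w x].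
  rewrite -hcontent_cube//; apply: le_trans (hcontentU _ _ _).
  apply: le_hcontent => x Px; have [tw|wt] := ltP t%:E (w x); [by right|left].
  by split=> //; exact: dual.
set h := H [set x | _]; have : 0 <= h by exact: hcontent_ge0.
case: h => [h||]//=; last by move=> *; rewrite gt0_muley ?lte_fin ?leey.
move: S_le; case: (H S) (hcontent_ge0 delta S) => [hS||]//=.
by rewrite -!EFinM -EFinD !lee_fin; lra.
Qed.

Lemma capacitary_weight_power w (gamma : R) : (0 < gamma)%R ->
  capacitary_weight delta w ->
  (forall P, choquet (cube_set P) (fun x => poweR (w x) (1 + gamma)) < +oo) ->
  capacitary_weight delta (fun x => poweR (w x) (1 + gamma)).
Proof.
move=> g0 [w0 _ wae] fin.
have g1 : (0 < 1 + gamma)%R by rewrite addr_gt0.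
split=> [x|E /compact_sub_cube[P EP]|]; first exact: poweR_ge0.
  by apply: le_lt_trans (fin P); apply: le_choquet.
apply: hcontent_sub0 wae => x /= nw /andP[wx0 wxy]; apply: nw.
by rewrite poweR_gt0// poweR_lty.
Qed.

End Averages.

(** * Powers of Muckenhoupt weights *)

Lemma poweRV (R : realType) (x : \bar R) (e : R) : 0 <= x -> e != 0%R ->
  poweR x^-1 e = (poweR x e)^-1.
Proof.
case: x => [r||]// r0 e0; last by rewrite invey poweR0r// poweRyr// invey.
move: r0; rewrite lee_fin le_eqVlt => /predU1P[<-|r0].
  by rewrite inve0 poweRyr// poweR0r// inve0.
rewrite inver gt_eqF// !poweR_EFin inver gt_eqF ?powR_gt0//; congr (_%:E).
by rewrite -powR_inv1 ?(ltW r0)// -powRrM mulrC powRrM powR_inv1 ?powR_ge0.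
Qed.

Section Weights.
Context {R : realType} {n : nat} (delta : R).
Hypothesis delta_n : (0 < delta <= n%:R)%R.
Implicit Types (w s : 'rV[R]_n -> \bar R) (P Q : cube R n).
Local Notation H := (@hcontent R n delta).
Local Notation choquet := (@choquet R n delta).
Local Notation vol Q := (edge Q `^ delta)%R.

Let delta_gt0 : (0 < delta)%R. Proof. by case/andP: delta_n. Qed.

Lemma weight_cube_fin w P : capacitary_weight delta w ->
  choquet (cube_set P) w < +oo.
Proof.
move=> [_ fin _]; have [E cE PE] := cube_sub_compact P.
by apply: le_lt_trans (fin E cE); apply: le_choquet.
Qed.

Lemma weight_cavg_gt0 w P : capacitary_weight delta w -> (0 < cavg delta w P)%R.
Proof.
move=> cw; have [w0 _ wae] := cw.
apply: cavg_gt0 => //; last exact: weight_cube_fin.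
by apply: hcontent_sub0 wae => x /= nw /andP[].
Qed.

Lemma power_average_le w gamma C P : (0 <= C)%R ->
  choquet (cube_set P) (fun x => poweR (w x) (1 + gamma)) <=
    (C * cavg delta w P `^ (1 + gamma) * vol P)%:E ->
  cube_average delta P (fun x => poweR (w x) (1 + gamma)) <=
    (C * cavg delta w P `^ (1 + gamma))%:E.
Proof.
move=> C0 le; rewrite cube_averageE// lee_pdivrMl ?vol_gt0//.
by rewrite -EFinM mulrC.
Qed.

(** Off the exceptional null set, [w x] is at least [K^-1] times the average of [w]
    over any cube containing [x]. This gives the hypothesis of [reverse_hoelder];
    conversely, the reverse Hoelder inequality bounds the averages of the power of
    [w] by the same power of the maximal function of [w]. *)
Lemma A1_power w : capacitary_weight delta w -> A1_const delta w < +oo ->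
  exists gamma : R, (0 < gamma < 1)%R /\
    (capacitary_weight delta (fun x => poweR (w x) (1 + gamma)) /\
     A1_const delta (fun x => poweR (w x) (1 + gamma)) < +oo).
Proof.
move=> cw /ereal_inf_lt[_ [K [K0 Mw] <-] _]; have [w0 _ _] := cw.
have wfin P := weight_cube_fin P cw.
have a0 P := weight_cavg_gt0 P cw.
have absw : (fun y => `|w y|) = w by apply/funext => y; rewrite gee0_abs.
have avg_le P x : cube_set P x -> (cavg delta w P)%:E <= capacitary_maximal delta w x.
  move=> Px; apply: ereal_sup_ubound; exists P => //.
  by rewrite absw cube_average_fin.
pose alpha : R := Num.min (2^-1)%R (2 * K)^-1%R.
have alpha0 : (0 < alpha)%R.
  by rewrite /alpha lt_min !invr_gt0 mulr_gt0//= ltr0n.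
have alpha2 : (alpha <= 2^-1)%R by rewrite /alpha ge_min lexx.
have alphaK : (alpha * K < 1)%R.
  apply: (@le_lt_trans _ _ ((2 * K)^-1 * K)%R).
    by rewrite ler_pM2r// /alpha ge_min lexx orbT.
  by rewrite invfM mulfVK ?gt_eqF// invf_lt1// ltr1n.
have large P : (vol P)%:E <=
    2%:E * H [set x | cube_set P x /\ (alpha * cavg delta w P)%:E < w x].
  rewrite -hcontent_cube//.
  set h := H [set x | _].
  apply: (@le_trans _ _ h); last first.
    rewrite -[leLHS]mul1e; apply: lee_wpmul2r; first exact: hcontent_ge0.
    by rewrite lee_fin ler1n.
  rewrite -[leRHS]add0e -[X in X + _]Mw; apply: le_trans (hcontentU _ _ _).
  apply: le_hcontent => x Px.
  have [MK|] := pselect (capacitary_maximal delta w x <= K%:E * w x); last by left.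
  right; split=> //; have := le_trans (avg_le P x Px) MK.
  have aw : (alpha * cavg delta w P < K^-1 * cavg delta w P)%R.
    by rewrite ltr_pM2r// -[ltRHS]mul1r ltr_pdivlMr.
  rewrite -lee_pdivrMl// => /lt_le_trans; apply.
  by rewrite -EFinM lte_fin.
have [g0 [C [g00 C0 RH]]] := reverse_hoelder delta_gt0 alpha0 alpha2 w0 wfin a0 large.
pose g : R := Num.min g0 (2^-1)%R.
have gg0 : (0 < g <= g0)%R.
  by rewrite /g lt_min g00 invr_gt0 ltr0n/= ge_min lexx.
have g_gt0 : (0 < g)%R by case/andP: gg0.
have g_lt1 : (g < 1)%R.
  apply: (@le_lt_trans _ _ (2^-1)%R); first by rewrite /g ge_min lexx orbT.
  by rewrite invf_lt1// ltr1n.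
exists g; split; first by rewrite g_gt0.
have cg := capacitary_weight_power g_gt0 cw.
split; first by apply: cg => P; apply: le_lt_trans (RH g P gg0) _; rewrite ltry.
have g1 : (0 <= 1 + g)%R by rewrite addr_ge0// ltW.
pose K' : R := (C * K `^ (1 + g))%R.
apply: (@le_lt_trans _ _ K'%:E); last by rewrite ltry.
apply: ereal_inf_lbound; exists K' => //; split; first by rewrite mulr_gt0 ?powR_gt0.
apply: hcontent_sub0 Mw => x /= nM MK; apply: nM.
apply: ge_ereal_sup => _ [P Px <-].
have -> : (fun y => `|poweR (w y) (1 + g)|) = (fun y => poweR (w y) (1 + g)).
  by apply/funext => y; rewrite gee0_abs ?poweR_ge0.
apply: (le_trans (power_average_le (ltW C0) (RH g P gg0))).
rewrite /K' 2!EFinM -muleA; apply: lee_wpmul2l; first by rewrite lee_fin ltW.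
rewrite -!poweR_EFin -poweRM ?lee_fin ?(ltW K0)//.
apply: poweR_le => //; first by rewrite lee_fin ltW.
exact: le_trans (avg_le P x Px) MK.
Qed.

Section Dual.
Variables (p : R) (w : 'rV[R]_n -> \bar R).
Hypotheses (p_gt1 : (1 < p)%R) (w_ge0 : forall x, 0 <= w x).
Let e := (p - 1)^-1%R.
Let p1_gt0 : (0 < p - 1)%R. Proof. by rewrite subr_gt0. Qed.
Let e_gt0 : (0 < e)%R. Proof. by rewrite invr_gt0. Qed.

(** The power [w `^ (- (p - 1)^-1)], with value [+oo] where [w] vanishes and 0
    where [w] is infinite. *)
Definition dual_weight x : \bar R := poweR (w x)^-1 (p - 1)^-1%R.

Lemma dual_weight_ge0 x : 0 <= dual_weight x.
Proof. exact: poweR_ge0. Qed.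

Lemma dual_weight_gt0 x : 0 < w x < +oo -> 0 < dual_weight x.
Proof.
rewrite /dual_weight; case: (w x) => [r||]//; last by rewrite ltxx andbF.
rewrite lte_fin => /andP[r0 _]; rewrite inver gt_eqF// poweR_EFin lte_fin.
by rewrite powR_gt0// invr_gt0.
Qed.

Lemma dual_weight_ge x t : (0 < t)%R -> w x <= t%:E ->
  (t `^ (- e))%:E <= dual_weight x.
Proof.
move=> t0 wt; rewrite /dual_weight powRN -powR_inv1 ?powR_ge0// -powRrM.
rewrite (mulrC e) powRrM powR_inv1 ?(ltW t0)// -poweR_EFin.
apply: poweR_le; [exact: ltW|by rewrite lee_fin invr_ge0 ltW|].
have -> : (t^-1)%:E = (t%:E)^-1 :> \bar R by rewrite inver gt_eqF.
by rewrite lee_pV2 ?inE ?w_ge0// lee_fin ltW.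
Qed.

Lemma dual_weight_le x t : (0 < t)%R -> dual_weight x <= t%:E ->
  (t `^ (- (p - 1)))%:E <= w x.
Proof.
move=> t0 st.
have le : (w x)^-1 <= poweR t%:E (p - 1).
  have := @poweR_le _ _ _ (p - 1)%R (ltW p1_gt0) (dual_weight_ge0 x) st.
  by rewrite /dual_weight -poweRrM mulVf ?gt_eqF// poweRe1// inve_ge0.
have -> : (t `^ (- (p - 1)))%:E = (poweR t%:E (p - 1))^-1.
  by rewrite powRN poweR_EFin inver gt_eqF// powR_gt0.
by rewrite inve_ple// inE ?w_ge0// poweR_ge0.
Qed.

Lemma dual_weight_power x g : (0 < g)%R ->
  poweR (poweR (w x) (1 + g))^-1 (p - 1)^-1%R = poweR (dual_weight x) (1 + g).
Proof.
move=> g0; rewrite /dual_weight poweRAC (poweRV (w_ge0 x))//.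
by rewrite gt_eqF// addr_gt0.
Qed.

End Dual.

(** The condition is symmetric in [w] and its dual weight [s], up to a power: with
    [a] and [b] their averages over a cube, [a * b `^ (p - 1) <= K] is the same as
    [a `^ e * b <= K `^ e]. So both satisfy a reverse Hoelder inequality, and with a
    common exponent the product of the averages of the powers is bounded by
    [(a * b `^ (p - 1)) `^ (1 + gamma)]. *)
Lemma Ap_power p w : (1 < p)%R -> capacitary_weight delta w ->
  Ap_const p delta w < +oo ->
  exists gamma : R, (0 < gamma < 1)%R /\
    (capacitary_weight delta (fun x => poweR (w x) (1 + gamma)) /\
     Ap_const p delta (fun x => poweR (w x) (1 + gamma)) < +oo).
Proof.
move=> p1 cw Apw; have [w0 _ wae] := cw.
have p1_gt0 : (0 < p - 1)%R by rewrite subr_gt0.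
pose e := (p - 1)^-1%R; have e0 : (0 < e)%R by rewrite invr_gt0.
pose s := dual_weight p w.
have s0 x : 0 <= s x by exact: dual_weight_ge0.
have wfin P := weight_cube_fin P cw.
have wa0 P := weight_cavg_gt0 P cw.
pose F P := cube_average delta P w * poweR (cube_average delta P s) (p - 1).
have FA P : F P <= Ap_const p delta w by apply: ereal_sup_ubound; exists P.
have [K K0 FK] : exists2 K : R, (0 < K)%R & forall P, F P <= K%:E.
  case: (Ap_const p delta w) Apw FA => [r||]// _ FA; last first.
    by exists 1%R => // P; apply: le_trans (FA P) _; rewrite leNye.
  exists (`|r| + 1)%R => [|P]; first by rewrite ltr_wpDl.
  apply: le_trans (FA P) _; rewrite lee_fin.
  by apply: le_trans (ler_norm r) _; rewrite lerDl.
have sfin P : choquet (cube_set P) s < +oo.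
  have := FK P; rewrite /F cube_average_fin// cube_averageE// ltNge.
  apply: contraL; rewrite leye_eq => /eqP ->.
  by rewrite gt0_muley ?lte_fin ?invr_gt0 ?vol_gt0// poweRyr ?gt_eqF//
    gt0_muley ?lte_fin.
have sa0 P : (0 < cavg delta s P)%R.
  apply: cavg_gt0 => //; apply: hcontent_sub0 wae => x /= ns wx.
  by apply: ns; exact: dual_weight_gt0.
have abK P : (cavg delta w P * cavg delta s P `^ (p - 1) <= K)%R.
  by have := FK P; rewrite /F !cube_average_fin// poweR_EFin -EFinM lee_fin.
have ab0 P : (0 <= cavg delta w P * cavg delta s P `^ (p - 1))%R.
  exact: mulr_ge0 (ltW (wa0 P)) (powR_ge0 _ _).
have abKe P : (cavg delta w P `^ e * cavg delta s P <= K `^ e)%R.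
  have -> : cavg delta s P = ((cavg delta s P `^ (p - 1)) `^ e)%R.
    by rewrite -powRrM mulfV ?gt_eqF// powRr1// ltW.
  rewrite -powRM ?powR_ge0 ?(ltW (wa0 P))//.
  by rewrite ge0_ler_powR ?nnegrE ?(ltW e0) ?(ltW K0) ?ab0 ?abK.
have [al [al0 al2 wlarge]] := dual_weight_large delta_n e0 (powR_gt0 e K0)
  wa0 sfin abKe (dual_weight_ge p1 w0).
have bKa P : (cavg delta s P `^ (p - 1) * cavg delta w P <= K)%R by rewrite mulrC.
have [be [be0 be2 slarge]] := dual_weight_large delta_n p1_gt0 K0
  sa0 wfin bKa (dual_weight_le p1 w0).
have [g1 [C1 [g10 C10 RHw]]] := reverse_hoelder delta_gt0 al0 al2 w0 wfin wa0 wlarge.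
have [g2 [C2 [g20 C20 RHs]]] := reverse_hoelder delta_gt0 be0 be2 s0 sfin sa0 slarge.
pose g : R := Num.min (Num.min g1 g2) (2^-1)%R.
have g_gt0 : (0 < g)%R by rewrite /g !lt_min g10 g20 invr_gt0 ltr0n.
have gg1 : (0 < g <= g1)%R by rewrite g_gt0 /g !ge_min lexx.
have gg2 : (0 < g <= g2)%R by rewrite g_gt0 /g !ge_min lexx orbT.
have g_lt1 : (g < 1)%R.
  apply: (@le_lt_trans _ _ (2^-1)%R); first by rewrite /g ge_min lexx orbT.
  by rewrite invf_lt1// ltr1n.
exists g; split; first by rewrite g_gt0.
split.
  apply: capacitary_weight_power => // P.
  by apply: le_lt_trans (RHw g P gg1) _; rewrite ltry.
have g0 : (0 <= 1 + g)%R by rewrite addr_ge0// ltW.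
apply: (@le_lt_trans _ _ (C1 * C2 `^ (p - 1) * K `^ (1 + g))%:E); last by rewrite ltry.
apply: ge_ereal_sup => _ [P _ <-].
rewrite (_ : (fun x => poweR (poweR (w x) (1 + g))^-1 (p - 1)^-1%R) =
  (fun x => poweR (s x) (1 + g))); last first.
  by apply/funext => x; exact: dual_weight_power.
have lew := power_average_le (ltW C10) (RHw g P gg1).
have les := power_average_le (ltW C20) (RHs g P gg2).
have lesp := poweR_le (ltW p1_gt0) (cube_average_ge0 delta_n _ P) les.
apply: (le_trans (lee_pmul (cube_average_ge0 delta_n _ P) (poweR_ge0 _ _) lew lesp)).
rewrite poweR_EFin -EFinM lee_fin.
rewrite (@powRM _ C2 (cavg delta s P `^ (1 + g))%R) ?powR_ge0 ?(ltW C20)//.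
rewrite -powRrM (mulrC (1 + g)%R) powRrM mulrACA -powRM ?powR_ge0 ?(ltW (wa0 P))//.
rewrite ler_wpM2l ?mulr_ge0 ?powR_ge0 ?(ltW C10)//.
by rewrite ge0_ler_powR ?nnegrE ?(ltW K0) ?ab0 ?abK.
Qed.

End Weights.

Local Close Scope ereal_scope.
Local Open Scope ring_scope.

Theorem corollary1p8 (R : realType) (n : nat) (delta p : R)
    (w : 'rV[R]_n -> \bar R)
    (hdelta : 0 < delta <= n%:R) (hp : 1 <= p)
    (hw : muckenhoupt p delta w) :
  exists gamma : R, 0 < gamma < 1 /\
    muckenhoupt p delta (fun x => poweR (w x) (1 + gamma)).
Proof.
have [cw] := hw; rewrite /muckenhoupt /Apd_const.
have [_|p1] := eqVneq p 1%R; first exact: A1_power.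
by apply: Ap_power => //; rewrite lt_neqAle eq_sym p1.
Qed.
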